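(* Let $d\ge2$ and $n\ge1$ be integers. For any $L\ge1$, there exists a positive constant $C=C(n,d,L)$ such that for any integer $M\ge1$, $$\mathbb{P}\big(A^\dagger_n[\infty]\cap\mathbb{Z}_M=A^\dagger_n[2M]\cap\mathbb{Z}_M\big)\ \ge\ 1-\frac{C}{M^L}.$$
   Context: Fix an integer $d\ge 2$. Let $\mathcal{H}=\{0\}\times\mathbb{Z}^{d-1}$ (the set of sources), $\mathcal{H}_M=\{0\}\times\{-M,\dots,M\}^{d-1}$ and $\mathbb{Z}_M=\mathbb{Z}\times\{-M,\dots,M\}^{d-1}$ for integers $M\ge 0$. Random inputs: $(\mathcal{N}_z)_{z\in\mathcal{H}}$ are i.i.d. Poisson point processes on $\mathbb{R}_+$ with intensity $1$; the successive points of $\mathcal{N}_z$ are $\tau_{z,1}<\tau_{z,2}<\cdots$. The $(S_{z,j})_{z\in\mathcal{H},j\ge1}$ are independent simple random walks on $\mathbb{Z}^d$, with $S_{z,j}(0)=z$, independent of the Poisson processes. Aggregates: given $M\ge0$, list the (a.s. finitely many) pairs $(z,j)$ with $z\in\mathcal{H}_M$ and $\tau_{z,j}\in[0,n]$ by increasing $\tau_{z,j}$ (a.s. distinct). Start from $A=\emptyset$; for each pair $(z,j)$ in turn, add to the current aggregate $A$ the first site visited by $S_{z,j}$ outside $A$. The final set is $A^\dagger_n[M]$. All aggregates are built from the same Poisson processes and walks; then a.s. $A^\dagger_n[M]\subset A^\dagger_n[M+1]$, and $A^\dagger_n[\infty]:=\bigcup_{M\ge0}A^\dagger_n[M]$.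 *)

(* Defs.v *)
From HB Require Import structures.
From mathcomp Require Import all_boot all_order all_algebra finmap.
From mathcomp Require Import all_classical all_reals all_analysis.
Import Order.TTheory GRing.Theory Num.Theory.
Import numFieldNormedType.Exports.

Set Implicit Arguments.
Unset Strict Implicit.
Unset Printing Implicit Defensive.

Local Open Scope card_scope.
Local Open Scope classical_set_scope.
Local Open Scope ring_scope.

Notation site d := 'rV[int]_d.

Definition source {d : nat} : set (site d) :=
  [set z : site d | forall i : 'I_d, (i : nat) = 0%N -> z 0 i = 0].

(* The set written Z_M: the constraint bears on all coordinates but the
   first one. *)
Definition cylinder {d : nat} (M : nat) : set (site d) :=
  [set z : site d | forall i : 'I_d, (i : nat) <> 0%N -> `|z 0 i| <= M%:Z].

Definition unit_step {d : nat} (x : site d) : bool :=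
  [exists i : 'I_d, (x == delta_mx 0 i) || (x == - delta_mx 0 i)].

Section probability_notions.
Context {R : realType} {disp : measure_display} {T : measurableType disp}.
Variable P : probability T R.

(* The generators used below are sigma-algebras, for which the product rule
   over finite subfamilies is independence of the sigma-algebras. *)
Definition mutually_independent {I : choiceType} (D : set I)
    (F : I -> set (set T)) : Prop :=
  forall (J : {fset I}) (E : I -> set T),
    [set` J] `<=` D -> (forall i, i \in J -> F i (E i)) ->
    P (\bigcap_(i in [set` J]) E i) = (\prod_(i <- J) P (E i))%E.

(* Sigma-algebra generated by a sequence of real random variables. *)
Definition sigma_real (X : nat -> T -> R) : set (set T) :=
  <<s [set A | exists k (B : set R), measurable B /\ A = X k @^-1` B] >>.

(* Sigma-algebra generated by a sequence of random variables valued in a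
   countable set. *)
Definition sigma_discrete {U : Type} (X : nat -> T -> U) : set (set T) :=
  <<s [set A | exists k (x : U), A = X k @^-1` [set x]] >>.

(* [tau j] is the (j+1)-st point of the process.  The point process is the set
   [{tau j w | j}]; as its points are distinct, the number of those lying in B
   is the cardinality of [[set j | B (tau j w)]].  The mean measure is Lebesgue
   measure on [0, +oo[; the joint law below expresses both that counts are
   Poisson and that counts in disjoint sets are independent.  (The library's
   [poisson_pmf] is not used: it is 1 everywhere at rate 0.) *)
Definition poisson_process (tau : nat -> T -> R) : Prop :=
  [/\ forall j, measurable_fun setT (tau j),
      {ae P, forall w, 0 <= tau 0%N w /\ forall j, tau j w < tau j.+1 w} &
      forall (k : nat) (B : 'I_k -> set R) (m : 'I_k -> nat),
        (forall i, measurable (B i)) ->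
        (forall i, B i `<=` [set x | 0 <= x]) ->
        (forall i, (lebesgue_measure (B i) < +oo)%E) ->
        trivIset setT B ->
        P [set w | forall i, [set j | B i (tau j w)] #= `I_(m i)] =
        (\prod_(i < k) (let r := fine (lebesgue_measure (B i)) in
           r ^+ m i / (m i)`!%:R * expR (- r)))%:E].

Definition simple_random_walk {d : nat} (z : site d)
    (S : nat -> T -> site d) : Prop :=
  let step k w := S k.+1 w - S k w in
  [/\ forall k x, measurable (S k @^-1` [set x]),
      forall w, S 0%N w = z,
      forall k x, P (step k @^-1` [set x]) =
        (if unit_step x then (2 * d)%:R^-1 else 0)%:E &
      mutually_independent [set: nat] (fun k => sigma_discrete (fun _ => step k))].

(* [tau z j] is the (j+1)-st point of the process at the source z and [S z j]
   is the walk attached to it.  Values at sites that are not sources are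
   unconstrained and never used. *)
Definition idla_inputs {d : nat} (tau : site d -> nat -> T -> R)
    (S : site d -> nat -> nat -> T -> site d) : Prop :=
  [/\ forall z, source z -> poisson_process (tau z),
      forall z j, source z -> simple_random_walk z (S z j) &
      mutually_independent
        [set a : site d + site d * nat |
           match a with inl z => source z | inr zj => source zj.1 end]
        (fun a => match a with
                  | inl z => sigma_real (tau z)
                  | inr zj => sigma_discrete (S zj.1 zj.2)
                  end)].

End probability_notions.

(* The aggregates for fixed realizations [t] of the point processes and [s] of
   the walks. *)
Section aggregates.
Context {R : realType} {d : nat}.
Variables (n : nat) (t : site d -> nat -> R)
  (s : site d -> nat -> nat -> site d).

(* At most one site; empty when the trajectory never leaves A. *)
Definition first_outside (A : set (site d)) (p : nat -> site d) :
    set (site d) :=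
  [set x | exists k, [/\ p k = x, ~ A x & forall i, (i < k)%N -> A (p i)]].

Definition arrivals (M : nat) : set (site d * nat) :=
  [set a | [/\ source a.1, cylinder M a.1 & 0 <= t a.1 a.2 <= n%:R]].

(* [fset_set] is the empty set on infinite sets, and [sort] breaks ties in an
   unspecified way: both situations have probability zero. *)
Definition arrival_list (M : nat) : seq (site d * nat) :=
  sort (fun a b => t a.1 a.2 <= t b.1 b.2) (fset_set (arrivals M)).

Definition aggregate (M : nat) : set (site d) :=
  foldl (fun A a => A `|` first_outside A (s a.1 a.2)) set0 (arrival_list M).

Definition aggregate_oo : set (site d) := \bigcup_M aggregate M.

End aggregates.

(* Main.v *)
Require Import Defs.
From HB Require Import structures.
From mathcomp Require Import all_boot all_order all_algebra finmap.
From mathcomp Require Import all_classical all_reals all_analysis.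
From mathcomp Require Import ring lra zify.
Import Order.TTheory GRing.Theory Num.Theory.
Import numFieldNormedType.Exports.

(* The aggregates of [H_N] and [H_(N+1)] are compared, and it is shown that they
   agree on [Z_(N/2)] outside an event whose probability decays faster than
   any power of [N]; the theorem follows by summing over [N >= 2M].

   All scales are powers of an integer [q] close to [N^(1/K)], [K] large.  A set
   of [V] sites is left by a simple random walk after about [V^(2/d)] steps, by
   the heat kernel bound.  Hence if every particle settles within distance
   [q^k] of its source, then a ball of radius [q^(k-1)] meets the aggregate in
   at most about [q (q^k)^(d-1)] sites, and, the walk being independent of the
   cluster formed by the previous particles, every particle in fact settles
   within distance [q^(k-1)].  Descending from a trivial bound one reaches a
   radius [rho = q^(3d+1)], which is a small power of [N].

   A discrepancy between the two aggregates is moved only by a particle that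
   starts and settles within [rho] of it.  Over a time slot of length [q^(-b)]
   the sources emitting a particle are so sparse that chains of such sources
   with steps at most [2 rho] have bounded length, so the discrepancies, born
   at distance [N+1] from the axis, come closer by [O(rho)] per slot, and by
   less than [N/2] up to time [n]. *)

Set Implicit Arguments.
Unset Strict Implicit.
Unset Printing Implicit Defensive.

Local Open Scope card_scope.
Local Open Scope classical_set_scope.
Local Open Scope ring_scope.

(** * Counting words and walks *)

(** A walk is independent of the cluster it meets, but the volume of this cluster is small only if
    the earlier particles settle near their sources. The circle is broken by putting the volume
    bound into the bad event itself ([stuck]): its probability is estimated with no information on
    the earlier particles, and the settling radius is lowered afterwards, realization by
    realization.

    The order in which the exponents are fixed matters. The descent stops at the exponent [3d+1],
    which depends on [d] alone, whatever power of [q] the number [N] is. The slots can thus be made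
    short compared with [rho^-(d-1)], so that each further source of a chain gains a factor [q];
    only then is [K] chosen, so large that the number of slots times [rho] is small compared with
    [N]. *)

Section words.
Context {T : finType}.

Fixpoint words (t : nat) : seq (seq T) :=
  if t is t'.+1 then [seq e :: u | e <- enum T, u <- words t'] else [:: [::]].

Lemma mem_words t u : (u \in words t) = (size u == t).
Proof.
elim: t u => [|t IH] u /=; first by rewrite inE size_eq0.
case: u => [|e u] /=.
  by apply/negbTE/allpairsPdep => -[e [u []]].
rewrite eqSS -IH; apply/allpairsPdep/idP => [[e' [u' [_ uu' [_ ->]]]] //|uP].
by exists e, u; rewrite mem_enum.
Qed.

Lemma big_words_S (V : nmodType) t (F : seq T -> V) :
  \sum_(u <- words t.+1) F u = \sum_e \sum_(u <- words t) F (e :: u).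
Proof. by rewrite big_allpairs_dep big_enum. Qed.

Lemma big_words_cat (V : nmodType) s t (F : seq T -> V) :
  \sum_(u <- words (s + t)) F u =
  \sum_(u <- words s) \sum_(v <- words t) F (u ++ v).
Proof.
elim: s F => [|s IH] F; first by rewrite big_seq1.
by rewrite addSn !big_words_S; apply: eq_bigr => e _; rewrite IH.
Qed.

Lemma size_words t : size (words t) = (#|T| ^ t)%N.
Proof.
by elim: t => [//|t IH]; rewrite size_allpairs IH expnS -cardE.
Qed.

(** An occurrence of [j] in a word of length [t+1] amounts to one of [t+1] positions and a word of
    length [t]; by invariance under permutations the occurrence can be moved to the front. *)
Lemma sum_count_words (R : pzSemiRingType) t j (F : seq T -> R) :
  (forall u v, perm_eq u v -> F u = F v) ->
  \sum_(u <- words t.+1) F u * (count_mem j u)%:R =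
  t.+1%:R * \sum_(u <- words t) F (j :: u).
Proof.
elim: t F => [|t IH] F Fp.
  rewrite big_words_S big_seq1 mul1r (bigD1 j) //= big_seq1 big1 ?addr0.
    by rewrite eqxx mulr1.
  by move=> i ij; rewrite big_seq1 /= (negPf ij) mulr0.
rewrite big_words_S.
under eq_bigr do under eq_bigr do rewrite natrD mulrDr.
under eq_bigr do rewrite big_split.
rewrite big_split /= (bigD1 j) //= [X in _ + X + _]big1 ?addr0; last first.
  by move=> i ij; rewrite big1 // => u _; rewrite (negPf ij) mulr0.
under eq_bigr do rewrite eqxx mulr1.
rewrite -[t.+2%:R]nat1r mulrDl mul1r; congr (_ + _).
transitivity (\sum_i (t.+1%:R * \sum_(u <- words t) F (i :: j :: u))).
  by apply: eq_bigr => i _; rewrite IH // => u v uv; apply: Fp; rewrite perm_cons.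
rewrite -mulr_sumr big_words_S; congr (_ * _); apply: eq_bigr => i _.
apply: eq_bigr => u _; apply: Fp.
by rewrite -cat1s -[X in perm_eq _ X]cat1s -[i :: u]cat1s -[j :: u]cat1s perm_catCA.
Qed.

(* A word of length [t] in which the letter [j] is not counted extends in
   [t+1] positions by [j]; every weight [1/(N_j+1)] is traded for one more
   letter. *)
Lemma sum_inv_counts (R : realFieldType) t (J : seq T) : uniq J ->
  (\sum_(u <- words t) \prod_(i <- J) (count_mem i u).+1%:R^-1) *
    t.+1%:R ^+ size J <= (#|T| ^ (t + size J))%:R :> R.
Proof.
elim: J t => [|j J IH] t.
  move=> _; rewrite expr0 mulr1 addn0 -size_words.
  by under eq_bigr do rewrite big_nil; rewrite big_tnth sumr_const card_ord.
move=> /= /andP[jJ uJ].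
(* Dividing by the number of letters [j] produces the weight [1/(N_j+1)] once a further [j] is put
   in front. Where [j] is absent this inverse is [0], so cancelling it below gives an inequality
   only. *)
pose F (u : seq T) : R := (\prod_(i <- J) (count_mem i u).+1%:R^-1) *
   (count_mem j u)%:R^-1.
have P0 u : 0 <= \prod_(i <- J) (count_mem i u).+1%:R^-1 :> R.
  by apply: prodr_ge0 => i _; rewrite invr_ge0 ler0n.
have Fp u v : perm_eq u v -> F u = F v.
  move=> /permP uv; rewrite /F uv; congr (_ / _).
  by apply: eq_bigr => i _; rewrite uv.
have := sum_count_words t j Fp.
have -> : \sum_(u <- words t) F (j :: u) =
    \sum_(u <- words t) \prod_(i <- j :: J) (count_mem i u).+1%:R^-1.
  apply: eq_bigr => u _; rewrite /F big_cons /= eqxx add1n mulrC; congr (_ * _).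
  apply: eq_big_seq => i iJ; case: eqVneq => // ji.
  by move: jJ; rewrite ji iJ.
move=> Fe; rewrite exprS mulrA [X in X * _]mulrC -Fe addnS -addSn.
apply: le_trans (IH t.+1 uJ); apply: ler_pM.
- by apply: sumr_ge0 => u _; rewrite /F !mulr_ge0 ?P0 ?invr_ge0 ?ler0n.
- by rewrite exprn_ge0.
- apply: ler_sum => u _; rewrite /F -mulrA ler_piMr ?P0 //.
  by have [->|c0] := posnP (count_mem j u); rewrite ?mulr0 // mulVf ?pnatr_eq0 ?lt0n_neq0.
- by rewrite lerXn2r ?nnegrE // ler_nat.
Qed.

End words.

(** The number of sequences of [N] signs with sum [y]. *)
Fixpoint sign_count (N : nat) (y : int) : nat :=
  if N is N'.+1 then (sign_count N' (y - 1) + sign_count N' (y + 1))%N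
  else y == 0.

Lemma sign_count_bin N :
  (forall k : nat, sign_count N (N%:Z - (2 * k)%N%:Z) = 'C(N, k)) /\
  (forall y, (forall k : nat, y <> N%:Z - (2 * k)%N%:Z) -> sign_count N y = 0%N).
Proof.
elim: N => [|N [IH1 IH2]]; split => [k|y yk] /=.
- by case: k => [|k] //=; apply/eqP; rewrite eqb0; lia.
- by apply/eqP; rewrite eqb0; apply/eqP => y0; apply: (yk 0%N); lia.
- have -> : N.+1%:Z - (2 * k)%N%:Z - 1 = N%:Z - (2 * k)%N%:Z by lia.
  rewrite IH1; case: k => [|k].
    by rewrite IH2 ?bin0 // => k; lia.
  have -> : N.+1%:Z - (2 * k.+1)%N%:Z + 1 = N%:Z - (2 * k)%N%:Z by lia.
  by rewrite IH1 binS.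
- rewrite !IH2 // => k yE; first by apply: (yk k.+1); lia.
  by apply: (yk k); lia.
Qed.

Lemma bin_mid_max N k : ('C(N, k) <= 'C(N, N./2))%N.
Proof.
have half m : (m <= N./2)%N -> ('C(N, m) <= 'C(N, N./2))%N.
  move=> mN; rewrite -(subKn mN); elim: (N./2 - m)%N {mN} => [|j IH].
    by rewrite subn0.
  have [jN|jN] := leqP (N./2) j.
    by have -> : (N./2 - j.+1 = N./2 - j)%N by lia.
  apply: leq_trans IH.
  have -> : (N./2 - j = (N./2 - j.+1).+1)%N by lia.
  set i := (N./2 - j.+1)%N.
  have := mul_bin_left N i; have : (i.+1 <= N - i)%N by rewrite /i; lia.
  by nia.
have [kN|kN] := leqP k N./2; first exact: half.
have [kN'|kN'] := leqP k N; last by rewrite bin_small.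
by rewrite -bin_sub //; apply: half; lia.
Qed.

(** Consecutive central coefficients have ratio [2(2m+1)/(m+1)], so the induction step reduces to
    [(2m+1)(2m+3) <= (2m+2)^2]. *)
Lemma central_bin_le m : ('C(2 * m, m) ^ 2 * (2 * m).+1 <= 4 ^ (2 * m))%N.
Proof.
elim: m => [//|m IH].
have e : ('C(2 * m.+1, m.+1) * m.+1 = 2 * (2 * m).+1 * 'C(2 * m, m))%N.
  have -> : (2 * m.+1 = (2 * m).+2)%N by lia.
  have h1 := mul_bin_down (2 * m).+1 m.
  have h2 : 'C((2 * m).+1, m.+1) = 'C((2 * m).+1, m).
    by rewrite -(@bin_sub (2 * m).+1 m); [congr (binomial _ _) | ]; lia.
  have h3 : ((2 * m).+1 - m = m.+1)%N by lia.
  rewrite /= h3 in h1; rewrite binS h2; nia.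
have -> : (4 ^ (2 * m.+1) = 16 * 4 ^ (2 * m))%N.
  by rewrite mulnS expnD.
rewrite -(leq_pmul2r (m := (m.+1 ^ 2)%N)) ?expn_gt0 //.
have -> : ('C(2 * m.+1, m.+1) ^ 2 * (2 * m.+1).+1 * m.+1 ^ 2 =
  (2 * (2 * m).+1 * 'C(2 * m, m)) ^ 2 * (2 * m.+1).+1)%N by rewrite -e; nia.
set B := 'C(2 * m, m) in IH *; set Q := (4 ^ (2 * m))%N in IH *.
have -> : ((2 * (2 * m).+1 * B) ^ 2 * (2 * m.+1).+1 =
  (B ^ 2 * (2 * m).+1) * (4 * (2 * m).+1 * (2 * m.+1).+1))%N by nia.
have -> : (16 * Q * m.+1 ^ 2 = Q * (16 * m.+1 ^ 2))%N by nia.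
by apply: leq_mul => //; nia.
Qed.

Lemma bin_sq_le N k : ('C(N, k) ^ 2 * N.+1 <= 4 ^ N)%N.
Proof.
apply: (@leq_trans ('C(N, N./2) ^ 2 * N.+1)%N).
  by rewrite leq_mul2r leq_sqr bin_mid_max orbT.
have := central_bin_le N./2; have := central_bin_le N./2.+1.
set m := N./2; have [Nm|Nm] : N = (2 * m)%N \/ N = (2 * m).+1.
- by have := odd_double_half N; rewrite -/m; case: odd; lia.
- by rewrite Nm.
rewrite Nm => + _; rewrite (mulnS 2 m).
(* For odd [N = 2m+1] the middle coefficient is half of a central one. *)
have -> : 'C(2 + 2 * m, m.+1) = (2 * 'C((2 * m).+1, m))%N.
  have h2 : 'C((2 * m).+1, m.+1) = 'C((2 * m).+1, m).
    by rewrite -(@bin_sub (2 * m).+1 m); [congr (binomial _ _) | ]; lia.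
  by rewrite -[(2 + 2 * m)%N]/(2 * m).+2 binS h2 addnn -mul2n.
rewrite expnD [(4 ^ (2 * m).+1)%N]expnS expnMn.
set B := 'C(_, _); set Q := (4 ^ (2 * m))%N.
set B2 := (B ^ 2)%N => H.
have : (4 * B2 * (2 + 2 * m).+1 <= 16 * Q)%N by [].
nia.
Qed.

Lemma sign_count_le N y : (sign_count N y ^ 2 * N.+1 <= 4 ^ N)%N.
Proof.
have [b1 b2] := sign_count_bin N.
have [zP|zP] := boolP ((0 <= N%:Z - y) && ~~ odd `|N%:Z - y|%N).
  have -> : y = N%:Z - (2 * `|N%:Z - y|%N./2)%N%:Z by lia.
  by rewrite b1 bin_sq_le.
by rewrite b2 // => k yE; move: zP; rewrite yE; lia.
Qed.

Section paths.
Context {d : nat}.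

Definition dir_vec (e : 'I_d * bool) : site d :=
  if e.2 then delta_mx 0 e.1 else - delta_mx 0 e.1.

Definition displacement (u : seq ('I_d * bool)) : site d :=
  \sum_(e <- u) dir_vec e.

Lemma displacement_cat u v :
  displacement (u ++ v) = displacement u + displacement v.
Proof. exact: big_cat. Qed.

Lemma dir_vecE e i :
  dir_vec e 0 i = if i == e.1 then (if e.2 then 1 else -1) else 0.
Proof.
by rewrite /dir_vec; case: e => j [] /=; rewrite !mxE ?eqxx /=; case: eqVneq;
  rewrite // oppr0.
Qed.

(** Words are grouped by the sequence [c] of their coordinates; the signs then remain free, and
    coordinate [i] receives [count_mem i c] of them. *)
Lemma sum_displacement t x :
  (\sum_(u <- words t) (displacement u == x) =
   \sum_(c <- words t) \prod_i sign_count (count_mem i c) (x 0%R i))%N.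
Proof.
elim: t x => [|t IH] x.
  rewrite !big_seq1 /displacement big_nil; have [<-|x0] := eqVneq 0%R x.
    by rewrite big1 // => i _; rewrite mxE.
  have /rV0Pn[i xi] : x != 0 by rewrite eq_sym.
  by rewrite (bigD1 i) //= (negPf xi).
rewrite !big_words_S.
rewrite (eq_bigr (fun e => \sum_(u <- words t) (displacement u == (x - dir_vec e)%R)))%N;
  last first.
  move=> e _; apply: eq_bigr => u _.
  by rewrite /displacement big_cons [in RHS]eq_sym subr_eq addrC [in RHS]eq_sym.
rewrite -(pair_bigA _ (fun i b =>
  \sum_(u <- words t) (displacement u == (x - dir_vec (i, b))%R)))%N /=.
apply: eq_bigr => i _; rewrite big_bool /= !IH -big_split /=.
apply: eq_bigr => c _.
have E b j : (x - dir_vec (i, b)) 0 j =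
    x 0 j - (if j == i then (if b then 1 else -1) else 0).
  by rewrite mxE [X in _ + X]mxE dir_vecE.
have S (f : 'I_d -> nat) : (\prod_j f j = f i * \prod_(j | j != i) f j)%N.
  by rewrite (bigD1 i).
rewrite !S -[LHS]/(addn _ _) !E !eqxx add1n /= opprK mulnDl.
by congr (_ * _ + _ * _)%N; apply: eq_bigr => j ji;
  rewrite E [i == j]eq_sym !(negPf ji) subr0.
Qed.

Lemma sum_count_mem (c : seq 'I_d) : (\sum_i count_mem i c = size c)%N.
Proof.
elim: c => [|a c IH] /=; first by rewrite big1.
rewrite big_split /= IH (bigD1 a) //= eqxx big1 ?addn0 // => i ia.
by rewrite eq_sym (negPf ia).
Qed.

(* Given the sequence [c] of coordinates of its steps, the coordinates of the
   walk are independent one-dimensional walks. *)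
Lemma heat_kernel t u x : (u ^ 2 <= t.+1)%N ->
  ((\sum_(w <- words t) (displacement w == x)) * u ^ d <=
   (d ^ d).+1 * (2 * d) ^ t)%N.
Proof.
move=> ut; rewrite sum_displacement -(ler_nat rat).
set p := fun c : seq 'I_d => (\prod_i sign_count (count_mem i c) (x ord0 i))%N.
pose W (c : seq 'I_d) : rat := \prod_(i <- enum 'I_d) (count_mem i c).+1%:R^-1.
have pW c : c \in words t -> (p c)%:R ^+ 2 <= (2 ^+ t) ^+ 2 * W c.
  rewrite mem_words => /eqP ct.
  have -> : (2 : rat) ^+ t ^+ 2 = \prod_i 4 ^+ count_mem i c.
    by rewrite -ct -sum_count_mem -exprM mulnC exprM -prodrXr.
  rewrite /p /W big_enum natr_prod -prodrXl -big_split /=.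
  apply: ler_prod => i _; rewrite exprn_ge0 //=.
  rewrite ler_pdivlMr // -!natrX -natrM ler_nat.
  exact: sign_count_le.
have /= S := sum_inv_counts rat t (enum_uniq 'I_d).
have sz : size (enum 'I_d) = d by rewrite size_enum_ord.
rewrite sz card_ord in S.
have b0 : (0 : rat) < 2 ^+ t by rewrite exprn_gt0.
rewrite natrM natr_sum -(ler_pM2l b0).
(* By [pW], [p c] is at most [2^t] times the square root of [W c], whereas only sums of [W] are
   under control. The inequality [x * y <= x^2 + y^2] with [x = p c * u^d] and [y = 2^t] removes the
   square root. *)
apply: (@le_trans _ _ (\sum_(c <- words t) ((2 ^+ t) ^+ 2 * (1 + W c * t.+1%:R ^+ d)))).
  rewrite mulrA mulr_sumr mulr_suml; rewrite !big_seq; apply: ler_sum => c /pW cW.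
  have u0 : (u ^ d)%:R ^+ 2 <= t.+1%:R ^+ d :> rat.
    by rewrite natrX exprAC -natrX lerXn2r ?nnegrE ?ler_nat ?ler0n.
  have : 0 <= ((2 ^+ t) - (p c)%:R * (u ^ d)%:R : rat) ^+ 2 by exact: sqr_ge0.
  have : ((p c)%:R * (u ^ d)%:R : rat) ^+ 2 <= (2 ^+ t) ^+ 2 * W c * t.+1%:R ^+ d.
    by rewrite exprMn; apply: ler_pM => //; exact: sqr_ge0.
  have : 0 <= (p c)%:R * (u ^ d)%:R * 2 ^+ t :> rat.
    by rewrite !mulr_ge0 ?ler0n ?exprn_ge0.
  nra.
rewrite -mulr_sumr expr2 -mulrA ler_pM2l // big_split /= -mulr_suml.
rewrite big_const_seq count_predT iter_addr_0 size_words card_ord.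
have -> : ((d ^ d).+1 * (2 * d) ^ t)%:R =
    2 ^+ t * ((d ^ t)%:R + (d ^ (t + d))%:R) :> rat.
  rewrite -natrX -natrD -natrM expnMn expnD; congr (_%:R).
  by set X := (2 ^ t)%N; set Y := (d ^ t)%N; set Z := (d ^ d)%N; nia.
by rewrite ler_pM2l // lerD2l.
Qed.
End paths.

Section counts.
Context {d : nat}.

(** The position is inspected only at multiples of [u^2]. Wherever a block of [u^2] steps starts,
    the heat kernel gives each site of [X] at most a fraction [(d^d+1)/u^d] of the words, so at most
    half of them end the block in [X]. *)
Lemma confined_words_le (X : seq (site d)) (u k : nat) (z : site d) :
  (0 < u)%N -> (2 * (size X * (d ^ d).+1) <= u ^ d)%N ->
  ((\sum_(v <- words (k * u ^ 2))
      all (fun i => (z + displacement (take (i * u ^ 2)%N v))%R \in X) (iota 1 k)) *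
    2 ^ k <= (2 * d) ^ (k * u ^ 2))%N.
Proof.
move=> u0 Xu; set t0 := (u ^ 2)%N.
elim: k z => [|k IH] z; first by rewrite big_seq1.
have first_step : (2 * \sum_(v <- words t0) ((z + displacement v)%R \in X) <=
    (2 * d) ^ t0)%N.
  have ud : (0 < u ^ d)%N by rewrite expn_gt0 u0.
  rewrite -(leq_pmul2r ud) -mulnA.
  apply: (@leq_trans (2 * (\sum_(x <- X) (d ^ d).+1 * (2 * d) ^ t0))%N); last first.
    rewrite big_const_seq count_predT iter_addn_0 [leqRHS]mulnC.
    have := leq_mul Xu (leqnn ((2 * d) ^ t0)%N).
    by set T := ((2 * d) ^ t0)%N; set D := (d ^ d).+1; nia.
  rewrite leq_mul2l /=.
  apply: (@leq_trans ((\sum_(x <- X) \sum_(v <- words t0)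
      (displacement v == (x - z)%R)) * u ^ d)%N).
    rewrite leq_mul2r; apply/orP; right.
    rewrite exchange_big /=; apply: leq_sum => v _.
    case: (boolP (_ \in X)) => // vX.
    by rewrite (big_rem _ vX) /= [in X in (_ == X)]addrAC subrr add0r eqxx.
  rewrite big_distrl /=; apply: leq_sum => x _.
  by apply: heat_kernel; rewrite /t0.
rewrite mulSn big_words_cat /=.
apply: (@leq_trans (\sum_(v1 <- words t0) ((z + displacement v1)%R \in X) *
   (2 * (2 * d) ^ (k * t0)))%N); last first.
  rewrite -big_distrl /= expnD mulnA leq_mul2r; apply/orP; right.
  by rewrite mulnC.
rewrite big_distrl /= !big_seq; apply: leq_sum => v1.
rewrite mem_words => /eqP v1s.
have e v2 : (all (fun i => (z + displacement (take (i * t0)%N (v1 ++ v2)))%R \in X)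
    (iota 1 k.+1) <= ((z + displacement v1)%R \in X) *
   all (fun i => (z + displacement v1 + displacement (take (i * t0)%N v2))%R \in X)
     (iota 1 k))%N.
  rewrite /= mul1n take_cat v1s ltnn subnn take0 cats0.
  case: (_ \in X) => //=; rewrite mul1n -[2%N]/(1 + 1)%N iotaDl all_map.
  rewrite (eq_all (a2 := fun i => (z + displacement v1 +
     displacement (take (i * t0)%N v2))%R \in X)) // => i /=.
  rewrite mulSn take_cat v1s ltnNge leq_addr /= addKn.
  by rewrite displacement_cat addrA.
apply: (@leq_trans ((\sum_(v2 <- words (k * t0)) ((z + displacement v1)%R \in X) *
   all (fun i => (z + displacement v1 + displacement (take (i * t0)%N v2))%R \in X)
     (iota 1 k)) * 2 ^ k.+1)%N).
  rewrite leq_mul2r; apply/orP; right; apply: leq_sum => v2 _; exact: e.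
rewrite -big_distrr /= -mulnA leq_mul2l expnS mulnCA leq_mul2l IH.
by rewrite !orbT.
Qed.

Lemma sum_exp_displacement (R : fieldType) (c : R) (i : 'I_d) t : c != 0 ->
  \sum_(w <- words t) c ^ (displacement w 0 i) =
  ((2 * d)%:R - 2 + c + c^-1) ^+ t.
Proof.
move=> c0; elim: t => [|t IH]; first by rewrite big_seq1 /displacement big_nil mxE.
rewrite big_words_S exprS -IH mulr_sumr exchange_big /=.
apply: eq_bigr => u _.
transitivity (\sum_(e : 'I_d * bool) c ^ dir_vec e 0 i * c ^ displacement u 0 i).
  by apply: eq_bigr => e _; rewrite /displacement big_cons mxE expfzDr.
rewrite -mulr_suml; congr (_ * _).
rewrite -(pair_bigA _ (fun j b => c ^ dir_vec (j, b) 0 i)) /= (bigD1 i) //=.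
rewrite big_bool /= !dir_vecE /= eqxx exprN1 expr1z.
rewrite (eq_bigr (fun=> 2)); last first.
  by move=> j ji; rewrite big_bool /= !dir_vecE /= eq_sym (negPf ji) !expr0z.
rewrite sumr_const cardC1 card_ord.
have -> : (2 * d)%:R = 2 + 2 *+ d.-1 :> R.
  by rewrite -mulrS prednK ?natrM ?mulr_natr // (leq_ltn_trans _ (ltn_ord i)).
by set y := 2 *+ _; set c1 := c^-1; ring.
Qed.

Lemma expn_lb (R : realFieldType) (y : R) n : 0 <= y -> 1 + n%:R * y <= (1 + y) ^+ n.
Proof.
move=> y0; elim: n => [|n IH]; first by rewrite mul0r addr0.
rewrite exprS -nat1r; have : 0 <= n%:R * y * y by rewrite !mulr_ge0.
have : (1 + y) * (1 + n%:R * y) <= (1 + y) * (1 + y) ^+ n.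
  by rewrite ler_wpM2l // addr_ge0.
by lra.
Qed.

(** Yields [(1 + x)^n <= 2] as soon as [n * x <= 1/2]. *)
Lemma expn_ub (R : realFieldType) (x : R) n : 0 <= x ->
  (1 + x) ^+ n * (1 - n%:R * x) <= 1.
Proof.
move=> x0; elim: n => [|n IH]; first by rewrite mul0r subr0 mulr1.
apply: le_trans IH; rewrite exprSr -mulrA ler_wpM2l ?exprn_ge0 ?addr_ge0 //.
have : 0 <= n%:R * x * x by rewrite !mulr_ge0.
by rewrite -nat1r; nra.
Qed.

(** Exponential Markov inequality with base [b = 1 + 1/v] or its inverse. Since
    [b + 1/b - 2 <= 1/v^2], the exponential moment over [t <= v^2] steps is at most twice the number
    of words, while a displacement [v * q] has weight at least [b^(v q) >= 2^q]. *)
Lemma far_words_le (i : 'I_d) (up : bool) t v q : (0 < v)%N -> (t <= v ^ 2)%N ->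
  ((\sum_(w <- words t) ((v * q)%N%:Z <= (if up then 1 else -1) * displacement w 0%R i)%R)
     * 2 ^ q <= 2 * (2 * d) ^ t)%N.
Proof.
move=> v0 tv; have d0 : (0 < d)%N by case: d i => [[]|].
have vR : (0 : rat) < v%:R by rewrite ltr0n.
pose b : rat := 1 + v%:R^-1; have b1 : 1 < b by rewrite /b ltrDl invr_gt0.
have b0 : 0 < b by exact: lt_trans b1.
pose c := if up then b else b^-1.
have c0 : c != 0 by rewrite /c; case: (up); rewrite ?invr_eq0 gt_eqF.
have cc : c + c^-1 = b + b^-1 by rewrite /c; case: (up); rewrite ?invrK // addrC.
have mass : \sum_(w <- words t) c ^ (displacement w 0 i) <= 2 * (2 * d)%:R ^+ t.
  rewrite sum_exp_displacement // -addrA cc.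
  set x : rat := (2 * v%:R ^+ 2)^-1.
  have x0 : 0 <= x by rewrite /x invr_ge0 mulr_ge0 ?exprn_ge0.
  have dR : (1 : rat) <= d%:R by rewrite ler1n.
  have bb : b + b^-1 - 2 <= v%:R^-1 ^+ 2.
    have -> : b + b^-1 - 2 = (b - 1) ^+ 2 / b by field; rewrite gt_eqF.
    rewrite ler_pdivrMr // /b addrAC subrr add0r ler_peMr ?sqr_ge0 //.
    by rewrite lerDl invr_ge0 ltW.
  have xE : v%:R^-1 ^+ 2 = 2 * x by rewrite /x; field; rewrite gt_eqF.
  have h1 : (2 * d)%:R - 2 + (b + b^-1) <= (2 * d)%:R * (1 + x).
    by rewrite natrM; nra.
  have h0 : 0 <= (2 * d)%:R - 2 + (b + b^-1).
    by rewrite natrM; have := invr_gt0 b; rewrite b0; nra.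
  have tx : t%:R * x <= 2^-1.
    rewrite /x invfM mulrCA ler_piMr // ler_pdivrMr ?exprn_gt0 // mul1r.
    by rewrite -natrX ler_nat.
  have hx : (1 + x) ^+ t <= 2.
    have := expn_ub t x0; have : 0 <= (1 + x) ^+ t by rewrite exprn_ge0 // addr_ge0.
    by nra.
  apply: (@le_trans _ _ ((2 * d)%:R ^+ t * (1 + x) ^+ t)).
    by rewrite -exprMn lerXn2r // nnegrE // mulr_ge0 // addr_ge0.
  by rewrite mulrC ler_wpM2r ?exprn_ge0.
have b2 : 2 ^+ q <= b ^+ (v * q).
  rewrite exprM lerXn2r ?nnegrE ?exprn_ge0 ?(ltW b0) //.
  have vi0 : 0 <= v%:R^-1 :> rat by rewrite invr_ge0 ltW.
  by have := expn_lb v vi0; rewrite mulfV ?gt_eqF.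
rewrite -(ler_nat rat) !natrM natr_sum natrX mulr_suml natrX.
apply: le_trans mass; apply: ler_sum => w _.
have cw : 0 <= c ^ displacement w 0 i.
  by rewrite exprz_ge0 // /c; case: (up); rewrite ?invr_ge0 ltW.
case: (boolP ((v * q)%N%:Z <= _)) => [h|_]; last by rewrite mulr0n mul0r.
rewrite mulr1n mul1r; apply: le_trans b2 _.
have -> : c ^ displacement w 0 i = b ^ ((if up then 1 else -1) * displacement w 0 i).
  by rewrite /c; case: (up); rewrite ?mul1r // mulN1r exprz_inv.
by rewrite [leLHS]exprnP; apply: ler_weXz2l => //; exact: ltW.
Qed.
End counts.

(** * Measurability and union bounds *)

Section measurable_predicates.
Context {disp : measure_display} {T : measurableType disp}.

Lemma measurable_ex (U : countType) (A : U -> T -> Prop) :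
  (forall u, measurable [set w | A u w]) -> measurable [set w | exists u, A u w].
Proof.
move=> mA; have -> : [set w | exists u, A u w] = \bigcup_u [set w | A u w].
  by apply/seteqP; split=> w [u] // ; exists u.
by apply: countable_bigcupT_measurable => //; exact: countableP.
Qed.

Lemma measurable_neg (A : T -> Prop) :
  measurable [set w | A w] -> measurable [set w | ~ A w].
Proof. exact: measurableC. Qed.

Lemma measurable_and (A B : T -> Prop) : measurable [set w | A w] ->
  measurable [set w | B w] -> measurable [set w | A w /\ B w].
Proof. exact: measurableI. Qed.

Lemma measurable_or (A B : T -> Prop) : measurable [set w | A w] ->
  measurable [set w | B w] -> measurable [set w | A w \/ B w].
Proof. exact: measurableU. Qed.

Lemma measurable_constant (A : Prop) : measurable [set _ : T | A].
Proof.
have [a|a] := pselect A.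
  by have -> : [set _ : T | A] = setT; [apply/seteqP; split | exact: measurableT].
by have -> : [set _ : T | A] = set0; [apply/seteqP; split | exact: measurable0].
Qed.

Lemma measurable_impl (A B : T -> Prop) : measurable [set w | A w] ->
  measurable [set w | B w] -> measurable [set w | A w -> B w].
Proof.
move=> mA mB; have -> : [set w | A w -> B w] = [set w | ~ A w \/ B w].
  apply/seteqP; split => w /=; first by case: (pselect (A w)); tauto.
  by tauto.
by apply: measurable_or => //; exact: measurable_neg.
Qed.

Lemma measurable_iff (A B : T -> Prop) : measurable [set w | A w] ->
  measurable [set w | B w] -> measurable [set w | A w <-> B w].
Proof. by move=> mA mB; apply: measurable_and; exact: measurable_impl. Qed.

Lemma measurable_all (U : countType) (A : U -> T -> Prop) :
  (forall u, measurable [set w | A u w]) -> measurable [set w | forall u, A u w].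
Proof.
move=> mA; have -> : [set w | forall u, A u w] = [set w | ~ exists u, ~ A u w].
  apply/seteqP; split => w /= wA; first by case=> u; apply.
  by move=> u; apply: contrapT => Au; apply: wA; exists u.
by apply: measurable_neg; apply: measurable_ex => u; exact: measurable_neg.
Qed.

Lemma measurable_preimage_countable (U : countType) (f : T -> U) (Y : U -> Prop) :
  (forall u, measurable [set w | f w = u]) -> measurable [set w | Y (f w)].
Proof.
move=> mf; have -> : [set w | Y (f w)] = [set w | exists u, f w = u /\ Y u].
  by apply/seteqP; split => w /=; [exists (f w) | case=> u [->]].
by apply: measurable_ex => u; apply: measurable_and => //; exact: measurable_constant.
Qed.

(** [f] factors through a finite vector of bits, hence through a countable set. This applies to
    lists sorted or filtered by real times, which depend on finitely many comparisons. *)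
Lemma measurable_by_bits (I : eqType) (V : Type) (s : seq I) (b : I -> T -> bool)
    (f : T -> V) (Y : set V) :
  (forall i, i \in s -> measurable [set w | b i w]) ->
  (forall w w', (forall i, i \in s -> b i w = b i w') -> f w = f w') ->
  measurable [set w | Y (f w)].
Proof.
move=> mb fb; pose c w := [seq b i w | i <- s].
pose Z v := exists2 w', c w' = v & Y (f w').
have -> : [set w | Y (f w)] = [set w | Z (c w)].
  apply/seteqP; split => w /=; first by exists w.
  case=> w' /eq_in_map cw Yw'; rewrite (fb w w') // => i si; exact/esym/cw.
apply: measurable_preimage_countable => v.
rewrite {Z}/c; elim: s mb {fb} v => [|i s IH] mb [|x v] /=;
  [exact: measurable_constant | exact: measurable_constant | |].
  by rewrite (_ : [set w | _] = set0) //; apply/seteqP; split.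
have -> : [set w | b i w :: [seq b j w | j <- s] = x :: v] =
    [set w | b i w = x /\ [seq b j w | j <- s] = v].
  by apply/seteqP; split=> w /= [-> ->].
apply: measurable_and; last first.
  by apply: IH => j js; apply: mb; rewrite inE js orbT.
have mbi := mb i (mem_head _ _); case: x => //.
have -> : [set w | b i w = false] = [set w | ~ b i w].
  by apply/seteqP; split=> w /=; [move=> -> | move/negP/negbTE].
exact: measurable_neg.
Qed.

End measurable_predicates.

Section union_bounds.
Context {R : realType} {disp : measure_display} {T : measurableType disp}.
Variable P : probability T R.

Lemma union_bound (I : eqType) (s : seq I) (A : I -> set T) (E : set T) :
  measurable E -> (forall i, i \in s -> measurable (A i)) ->
  (forall w, E w -> exists2 i, i \in s & A i w) ->
  (P E <= \sum_(i <- s) P (A i))%E.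
Proof.
elim: s E => [|i s IH] E mE mA EA.
  have -> : E = set0 by apply/seteqP; split=> w // /EA[].
  by rewrite measure0 big_nil.
rewrite big_cons; have mAi := mA i (mem_head _ _).
have E' : (P (E `\` A i) <= \sum_(j <- s) P (A j))%E.
  apply: IH => [|j js|w [Ew nAi]]; first exact: measurableD.
  - by apply: mA; rewrite inE js orbT.
  - by have [j] := EA w Ew; rewrite inE => /orP[/eqP->//|js Aj]; exists j.
apply: le_trans (leeD (lexx _) E').
have mEA : measurable (E `\` A i) by exact: measurableD.
apply: (@le_trans _ _ (P (A i `|` (E `\` A i)))); last exact: measureU2.
rewrite le_measure ?inE //; first exact: measurableU.
by move=> w Ew; have [|] := pselect (A i w); [left | right].
Qed.

Lemma union_bound_const (I : eqType) (s : seq I) (A : I -> set T) (E : set T)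
    (c : R) :
  measurable E -> (forall i, i \in s -> measurable (A i)) ->
  (forall i, i \in s -> (P (A i) <= c%:E)%E) ->
  (forall w, E w -> exists2 i, i \in s & A i w) ->
  (P E <= ((size s)%:R * c)%:E)%E.
Proof.
move=> mE mA Ac EA; apply: le_trans (union_bound mE mA EA) _.
have -> : (size s)%:R * c = \sum_(i <- s) c.
  by rewrite big_const_seq count_predT iter_addr_0 mulr_natl.
by rewrite -sumEFin !big_seq; apply: lee_sum => i /Ac.
Qed.

Lemma negligible_ex (U : countType) (A : U -> set T) :
  (forall u, P.-negligible (A u)) -> P.-negligible [set w | exists u, A u w].
Proof.
move=> A0; pose F n := if (@choice.unpickle U n) is Some u then A u else set0.
apply: (@negligibleS _ _ _ _ (\bigcup_n F n)).
  by move=> w [u Auw]; exists (choice.pickle u) => //; rewrite /F choice.pickleK.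
apply: negligible_bigcup => n; rewrite /F; case: (@choice.unpickle U n) => [u|].
  exact: A0.
exact: negligible_set0.
Qed.

Lemma null_ex (U : countType) (A : U -> set T) :
  (forall u, measurable (A u)) -> (forall u, P (A u) = 0%E) ->
  P [set w | exists u, A u w] = 0%E.
Proof.
move=> mA A0; apply: measure_negligible; first exact: measurable_ex.
by apply: negligible_ex => u; exists (A u); split; [exact: mA | exact: A0 | by []].
Qed.

End union_bounds.

(** * Bounds for the simple random walk *)

Section walk_law.
Context {R : realType} {disp : measure_display} {T : measurableType disp}.
Variable P : probability T R.
Context {d : nat} (z : site d) (S : nat -> T -> site d).
Hypothesis SRW : simple_random_walk P z S.

Let step k w := S k.+1 w - S k w.

Lemma walk_measurable k x : measurable [set w | S k w = x].
Proof. by case: SRW => mS _ _ _; exact: mS. Qed.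

Lemma step_measurable k x : measurable [set w | step k w = x].
Proof.
have -> : [set w | step k w = x] = [set w | exists y, S k w = y /\ S k.+1 w = x + y].
  apply/seteqP; split => w /=.
    by move=> <-; exists (S k w); rewrite /step subrK.
  by case=> y [<-]; rewrite /step => ->; rewrite addrK.
apply: measurable_ex => y.
by apply: measurable_and; exact: walk_measurable.
Qed.

Lemma step_unit k : P [set w | ~~ unit_step (step k w)] = 0%E.
Proof.
have -> : [set w | ~~ unit_step (step k w)] =
    [set w | exists x, [set w | ~~ unit_step x /\ step k w = x] w].
  apply/seteqP; split => w /=; first by exists (step k w).
  by case=> x [xu ->].
apply: null_ex => x.
  by apply: measurable_and; [exact: measurable_constant | exact: step_measurable].
case: SRW => _ _ law _; have := law k x.
have [xu _|xu L] := boolP (unit_step x).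
  by rewrite (_ : [set w | _] = set0) ?measure0 //; apply/seteqP; split => w // [].
by apply: etrans L; congr (P _); apply/seteqP; split => w //= [].
Qed.

Lemma unit_step_dir (x : site d) : unit_step x -> exists e, x = dir_vec e.
Proof.
by move=> /existsP[i /orP[] /eqP ->]; [exists (i, true) | exists (i, false)].
Qed.

Lemma dir_unit_step e : unit_step (dir_vec e : site d).
Proof.
case: e => i b; apply/existsP; exists i.
by case: b; rewrite /dir_vec /= eqxx ?orbT.
Qed.

Lemma walk_word e0 (u : seq ('I_d * bool)) :
  P [set w | forall k, (k < size u)%N -> step k w = dir_vec (nth e0 u k)] =
  (((2 * d)%:R ^- size u)%:E)%E.
Proof.
case: SRW => _ _ law ind.
pose J := [fset k | k in iota 0 (size u)]%fset.
have JE k : (k \in J) = (k < size u)%N.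
  by rewrite /J !inE /= mem_iota.
pose E k := step k @^-1` [set dir_vec (nth e0 u k)].
have -> : [set w | forall k, (k < size u)%N -> step k w = dir_vec (nth e0 u k)] =
    \bigcap_(k in [set` J]) E k.
  apply/seteqP; split => w /= H k; first by rewrite /= JE => /H.
  by move=> ku; apply: H; rewrite /= JE.
rewrite ind // => [|k kJ]; last by apply: sub_sigma_algebra; exists 0%N, (dir_vec (nth e0 u k)).
rewrite (eq_bigr (fun=> ((2 * d)%:R^-1)%:E)); last first.
  by move=> k _; rewrite law dir_unit_step.
have -> : size u = size J by rewrite -[LHS](size_iota 0) /J; apply/esym; rewrite card_imfset //= undup_id ?iota_uniq.
elim: (enum_fset J) => [|k s IH]; first by rewrite big_nil expr0 invr1.
by rewrite big_cons IH /= exprS invfM EFinM.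
Qed.

(* Up to a null set, the first [t] steps of the walk spell a word. *)
Lemma walk_event_le (hd : (0 < d)%N) (t : nat) (Q : pred (seq ('I_d * bool))) (E : set T) :
  measurable E ->
  (forall w u, E w -> size u = t ->
     (forall i, (i <= t)%N -> S i w = z + displacement (take i u)) -> Q u) ->
  (P E <= (((\sum_(u <- words t) Q u)%N)%:R / (2 * d)%:R ^+ t)%:E)%E.
Proof.
move=> mE EQ; pose e0 := (Ordinal hd, true).
(* [None] stands for the null event that some step is not a unit vector, so that [E] is covered
   everywhere and not only almost everywhere. *)
pose A (o : option (seq ('I_d * bool))) := if o is Some u then
    [set w | forall k, (k < size u)%N -> step k w = dir_vec (nth e0 u k)]
  else [set w | exists k, ~~ unit_step (step k w)].
have mN k : measurable [set w | ~~ unit_step (step k w)].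
  apply: (@measurable_preimage_countable _ _ _ (step k) (fun x => ~~ unit_step x)).
  exact: step_measurable.
have mA o : measurable (A o).
  case: o => [u|] /=; last exact: measurable_ex.
  apply: measurable_all => k; apply: measurable_impl.
    exact: measurable_constant.
  exact: step_measurable.
have := @union_bound _ _ _ P _ (None :: [seq Some u | u <- words t & Q u]) A E mE.
move=> /(_ (fun o _ => mA o)) /= H; apply: le_trans (H _) _ => {H} [w Ew|].
  have [noU|] := pselect (exists k, ~~ unit_step (step k w)).
    by exists None; rewrite ?mem_head.
  move=> allU; have {}allU k : exists e, step k w = dir_vec e.
    apply: unit_step_dir; apply: contrapT => /negP nU; apply: allU.
    by exists k.
  have [e eE] := choice allU.
  pose u := [seq e k | k <- iota 0 t].
  have us : size u = t by rewrite size_map size_iota.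
  exists (Some u) => /=.
    rewrite inE map_f // mem_filter mem_words us eqxx andbT.
    apply: (EQ w) => // i; elim: i => [|i IH] it.
      by rewrite take0 /displacement big_nil addr0; case: SRW.
    rewrite (take_nth e0) ?us // -cats1 displacement_cat addrA -IH ?(ltnW it) //.
    rewrite /displacement big_seq1 (nth_map 0%N) ?size_iota // nth_iota //.
    by rewrite -eE add0n /step addrC subrK.
  by move=> k; rewrite us => kt; rewrite (nth_map 0%N) ?size_iota // nth_iota // eE.
rewrite big_cons /= null_ex ?add0e //; last by move=> k; exact: step_unit.
rewrite big_map big_filter big_seq_cond.
rewrite (eq_bigr (fun=> (((2 * d)%:R ^- t)%:E)%E)); last first.
  by move=> u /andP[]; rewrite mem_words => /eqP <- _; rewrite walk_word.
rewrite -big_seq_cond sumEFin lee_fin natr_sum mulr_suml big_mkcond /=.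
apply: ler_sum => u _; case: (Q u); rewrite ?mul1r // mul0r.
Qed.

End walk_law.

Definition near {d} (r : nat) (x y : site d) : bool :=
  [forall i, `|x 0 i - y 0 i| <= r%:Z].

Section walk_bounds.
Context {R : realType} {disp : measure_display} {T : measurableType disp}.
Variable P : probability T R.
Context {d : nat} (hd : (0 < d)%N) (z : site d) (S : nat -> T -> site d).
Hypothesis SRW : simple_random_walk P z S.

Lemma measurable_walk (Y : site d -> Prop) k : measurable [set w | Y (S k w)].
Proof.
apply: (@measurable_preimage_countable _ _ _ (S k) Y) => x.
exact: walk_measurable SRW k x.
Qed.

Lemma confined_walk_le (X : seq (site d)) (u k : nat) :
  (0 < u)%N -> (2 * (size X * (d ^ d).+1) <= u ^ d)%N ->
  (P [set w | forall i, (i <= k * u ^ 2)%N -> S i w \in X] <= ((2 ^ k)%:R^-1)%:E)%E.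
Proof.
move=> u0 Xu.
apply: le_trans (walk_event_le SRW hd (t := k * u ^ 2)
  (Q := fun v => all (fun i => z + displacement (take (i * u ^ 2)%N v) \in X) (iota 1 k))
  _ _) _.
- apply: measurable_all => i; apply: measurable_impl.
    exact: measurable_constant.
  exact: measurable_walk (fun x => x \in X) i.
- move=> w v wX vs Sv; apply/allP => i; rewrite mem_iota => ik.
  rewrite -Sv; first by apply: wX; rewrite leq_mul2r; lia.
  by rewrite leq_mul2r; lia.
have d2 : (0 : R) < (2 * d)%:R by rewrite ltr0n muln_gt0.
rewrite lee_fin ler_pdivrMr ?exprn_gt0 // ler_pdivlMl ?ltr0n ?expn_gt0 //.
by rewrite -natrX -natrM ler_nat mulnC confined_words_le.
Qed.

Lemma far_walk_le t v q : (0 < v)%N -> (t <= v ^ 2)%N ->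
  (P [set w | ~~ near (v * q)%N (S t w) z] <= ((4 * d)%:R / (2 ^ q)%:R)%:E)%E.
Proof.
move=> v0 tv.
pose Q (i : 'I_d) (up : bool) (u : seq ('I_d * bool)) :=
  (v * q)%N%:Z <= (if up then 1 else -1) * displacement u 0 i.
apply: le_trans (walk_event_le SRW hd (t := t)
  (Q := fun u => [exists i, Q i true u || Q i false u]) _ _) _.
- exact: measurable_walk (fun x => ~~ near (v * q) x z) t.
- move=> w u /= nw us Su; move: nw.
  rewrite Su // -us take_size => /forallPn[i]; rewrite mxE addrAC subrr add0r => iu.
  apply/existsP; exists i; rewrite /Q !mul1r !mulN1r.
  by move: iu; rewrite -ltNge ltr_normr => /orP[] /ltW ->; rewrite ?orbT.
have d2 : (0 : R) < (2 * d)%:R by rewrite ltr0n muln_gt0.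
rewrite lee_fin ler_pdivrMr ?exprn_gt0 // mulrAC ler_pdivlMr ?ltr0n ?expn_gt0 //.
rewrite -natrX -!natrM ler_nat.
apply: (@leq_trans ((\sum_(i < d) \sum_(b : bool) \sum_(u <- words t) Q i b u) * 2 ^ q)%N).
  rewrite leq_mul2r; apply/orP; right.
  apply: (@leq_trans (\sum_(u <- words t) \sum_(i < d) \sum_(b : bool) Q i b u)%N);
    last by rewrite exchange_big; apply: leq_sum => i _; rewrite exchange_big.
  apply: leq_sum => u _.
  case: existsP => // -[i Qi]; rewrite (bigD1 i) //= big_bool.
  by rewrite !addn_gt0 !lt0b Qi.
rewrite big_distrl /=.
apply: (@leq_trans (\sum_(i < d) 4 * (2 * d) ^ t)%N); last first.
  by rewrite sum_nat_const card_ord mulnA [(4 * d)%N]mulnC.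
apply: leq_sum => i _; rewrite big_bool /=.
have := far_words_le i true q v0 tv; have := far_words_le i false q v0 tv.
rewrite -/(Q i true) -/(Q i false).
set a := (\sum_(u <- words t) Q i true u)%N; set b := (\sum_(u <- words t) Q i false u)%N.
move=> hb ha; rewrite mulnDl.
by apply: leq_trans (leq_add ha hb) _; rewrite -mulnDl.
Qed.

Lemma far_walk_upto_le t v q : (0 < v)%N -> (t <= v ^ 2)%N ->
  (P [set w | exists i, (i <= t)%N /\ ~~ near (v * q)%N (S i w) z] <=
   (t.+1%:R * ((4 * d)%:R / (2 ^ q)%:R))%:E)%E.
Proof.
move=> v0 tv; rewrite -[t.+1](size_iota 0).
have mA i : measurable [set w | ~~ near (v * q) (S i w) z].
  exact: measurable_walk (fun x => ~~ near (v * q) x z) i.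
apply: (union_bound_const (A := fun i => [set w | ~~ near (v * q) (S i w) z])) => //.
- apply: measurable_ex => i; apply: measurable_and => //.
  exact: measurable_constant.
- move=> i; rewrite mem_iota /= => it; apply: far_walk_le => //; lia.
- by move=> w [i [it wi]]; exists i => //; rewrite mem_iota.
Qed.

End walk_bounds.

(** * Independence *)

Section independence.
Context {R : realType} {disp : measure_display} {T : measurableType disp}.
Variable P : probability T R.

Lemma sigma_algebraI (F : set (set T)) : sigma_algebra setT F -> setI_closed F.
Proof.
move=> sF A B FA FB; rewrite -(measurable_g_measurableTypeE sF).
by apply: measurableI; rewrite measurable_g_measurableTypeE.
Qed.

(** Finite intersections of events from the families other than [a] form a pi-system [G]. There the
    product rule, applied with [a] adjoined, shows that the finite measures sending [X] to
    [P (X & E)] and to [P X * P E] agree; uniqueness of measures carries this over to the generated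
    sigma-algebra. *)
Lemma mutually_independent_generated {I : choiceType} (D : set I)
    (F : I -> set (set T)) (a : I) (E X : set T) :
  mutually_independent P D F ->
  (forall i, D i -> sigma_algebra setT (F i)) ->
  (forall i, D i -> F i `<=` measurable) ->
  D a -> F a E -> <<s [set X | exists i, [/\ D i, i != a & F i X]] >> X ->
  P (X `&` E) = (P X * P E)%E.
Proof.
move=> ind sF mF Da FE.
pose G := [set X | exists (J : {fset I}) (B : I -> set T),
   [/\ forall i, i \in J -> D i /\ i != a, forall i, i \in J -> F i (B i) &
       X = \bigcap_(i in [set` J]) B i]].
have FT i : D i -> F i setT.
  by move=> Di; have [F0 FC _] := sF i Di; rewrite -[setT](setD0); exact: FC.
have Gm : G `<=` measurable.
  move=> _ [J [B [JD FB ->]]]; apply: fin_bigcap_measurable => [|i /= iJ].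
    exact: finite_fset.
  by apply: mF (FB i iJ); case: (JD i iJ).
have mE : measurable E by exact: mF FE.
have PE0 : 0 <= fine (P E) by rewrite fine_ge0.
have PEf : P E = (fine (P E))%:E by rewrite fineK ?fin_num_measure.
have GI : setI_closed G.
  move=> _ _ [J1 [B1 [D1 F1 ->]]] [J2 [B2 [D2 F2 ->]]].
  exists (J1 `|` J2)%fset, (fun i => (if i \in J1 then B1 i else setT) `&`
    (if i \in J2 then B2 i else setT)); split => [i|i|].
  - by rewrite inE => /orP[/D1|/D2].
  - rewrite inE => iJ; have Di : D i by case/orP: iJ => [/D1|/D2] [].
    apply: (sigma_algebraI (sF i Di)); case: ifP => //.
    + by move/F1.
    + by move=> _; exact: FT.
    + by move/F2.
    + by move=> _; exact: FT.
  - apply/seteqP; split => w /=.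
      move=> [w1 w2] i /= iJ; split; case: ifP => // iJ'; first exact: w1.
      exact: w2.
    move=> wB; split => i /= iJ.
      by have := wB i; rewrite /= inE iJ /= => /(_ isT) [].
    by have := wB i; rewrite /= inE iJ orbT /= => /(_ isT) [].
have sG : <<s [set X | exists i, [/\ D i, i != a & F i X]] >> `<=` <<s G >>.
  apply: sub_smallest2r; first exact: smallest_sigma_algebra.
  move=> Y [i [Di ia FY]].
  exists [fset i]%fset, (fun=> Y); split => [j|j|].
  - by rewrite inE => /eqP ->.
  - by rewrite inE => /eqP ->.
  - apply/seteqP; split => w /=; first by move=> ? j.
    by apply; rewrite /= inE.
move=> /sG sX.
suff h : mrestr P mE X = mscale (NngNum PE0) P X.
  by rewrite [in RHS]PEf muleC; exact: h.
apply: (g_sigma_algebra_measure_unique G Gm (fun=> setT)) => //.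
- move=> _; exists fset0, (fun=> setT); split => [i|i|]; rewrite ?inE //.
  by apply/seteqP; split.
- by rewrite bigcup_const.
- move=> _ [J [B [JD FB ->]]].
  suff h : P (\bigcap_(i in [set` J]) B i `&` E) = (P (\bigcap_(i in [set` J]) B i) * P E)%E.
    by apply: etrans h _; apply: etrans (congr1 _ PEf) (muleC _ _).
  have aJ : a \notin J by apply/negP => /JD[_]; rewrite eqxx.
  have i1 := ind (a |` J)%fset (fun i => if i == a then E else B i).
  have i2 := ind J B; rewrite i2 //; last by move=> i /= /JD[].
  have -> : \bigcap_(i in [set` J]) B i `&` E =
      \bigcap_(i in [set` (a |` J)%fset]) (if i == a then E else B i).
    apply/seteqP; split => w /=.
      move=> [wB wE] i /=; rewrite !inE; case: eqVneq => [//|ia] /= iJ.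
      exact: wB.
    move=> wB; split; last by have := wB a; rewrite /= !inE eqxx; apply.
    move=> i /= iJ; have := wB i; rewrite /= !inE iJ orbT => /(_ isT).
    by have [_ /negPf ->] := JD i iJ.
  rewrite i1 => [||i].
  - rewrite big_fsetU1 //= eqxx muleC; congr (_ * _)%E; apply: eq_big_seq => i iJ.
    by have [_ /negPf ->] := JD i iJ.
  - by move=> i /=; rewrite !inE => /orP[/eqP->//|/JD[]].
  - rewrite !inE; case: eqVneq => [->//|ia] /= iJ; exact: FB.
- move=> _; rewrite /mrestr; apply: le_lt_trans (probability_le1 _ _) _; rewrite ?ltry //.
  exact: measurableI.
Qed.

End independence.

(** * Poisson processes *)

(** Each term of index [k > m] satisfies [x^k / k! <= (2x)^k / k! / 2^m]. *)
Lemma expR_tail_le (R : realType) (x : R) m : 0 <= x ->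
  expR x <= \sum_(k < m.+1) x ^+ k / k`!%:R + expR (2 * x) / 2 ^+ m.
Proof.
move=> x0; rewrite {1}/expR; apply: limr_le; first exact: is_cvg_series_exp_coeff.
apply: nearW => N.
have e2 : series (exp_coeff (2 * x)) N <= expR (2 * x).
  apply: nondecreasing_cvgn_le; last exact: is_cvg_series_exp_coeff.
  apply/nondecreasing_seqP => i.
  by rewrite /series /= big_nat_recr //= lerDl exp_coeff_ge0 // mulr_ge0.
have -> : \sum_(k < m.+1) x ^+ k / k`!%:R = series (exp_coeff x) m.+1.
  by rewrite /series /= big_mkord.
apply: (@le_trans _ _ (series (exp_coeff x) m.+1 + series (exp_coeff (2 * x)) N / 2 ^+ m)); last first.
  by rewrite lerD2l ler_wpM2r // invr_ge0 exprn_ge0.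
have c0 y i : 0 <= y -> 0 <= exp_coeff y i :> R by exact: exp_coeff_ge0.
have s0 y i : 0 <= y -> 0 <= series (exp_coeff y) i :> R.
  by move=> y0; rewrite /series /= sumr_ge0 // => j _; exact: c0.
have x20 : 0 <= 2 * x by rewrite mulr_ge0.
elim: N {e2} => [|N IH].
  rewrite [leLHS]/series /= big_geq // addr_ge0 ?s0 //.
  by rewrite divr_ge0 ?s0 ?exprn_ge0.
have [Nm|Nm] := leqP N m.
  apply: (@le_trans _ _ (series (exp_coeff x) m.+1)).
    rewrite /series /= (big_cat_nat _ (n := N.+1) (p := m.+1)) //= lerDl.
    by rewrite sumr_ge0 // => i _; exact: c0.
  by rewrite lerDl divr_ge0 ?s0 ?exprn_ge0.
have sS y : series (exp_coeff y) N.+1 = series (exp_coeff y) N + exp_coeff y N :> R.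
  by rewrite /series /= big_nat_recr.
rewrite !sS mulrDl addrA; apply: lerD => //.
have -> : exp_coeff (2 * x) N / 2 ^+ m = 2 ^+ N / 2 ^+ m * exp_coeff x N.
  rewrite /exp_coeff /= exprMn; move: (2 ^+ m)^-1 (N`!%:R^-1) => y1 y2; ring.
rewrite ler_peMl ?c0 // ler_pdivlMr ?exprn_gt0 // mul1r.
by apply: ler_weXn2l; [rewrite ler1n | exact: ltnW].
Qed.

Section poisson.
Context {R : realType} {disp : measure_display} {T : measurableType disp}.
Variable P : probability T R.
Variable tau : nat -> T -> R.
Hypothesis PP : poisson_process P tau.

Lemma measurable_point (B : set R) j : measurable B -> measurable [set w | B (tau j w)].
Proof.
by move=> mB; case: PP => mt _ _; rewrite -[X in measurable X]setTI; exact: mt.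
Qed.

Lemma measurable_point_itv (i : interval R) j : measurable [set w | tau j w \in i].
Proof. by apply: (@measurable_point [set` i]); exact: measurable_itv. Qed.

Lemma measurable_count (i : interval R) k :
  measurable [set w | [set j | tau j w \in i] #= `I_k].
Proof.
have -> : [set w | [set j | tau j w \in i] #= `I_k] =
  [set w | exists X : {fset nat}, #|` X| = k /\ forall j, tau j w \in i <-> j \in X].
  apply/seteqP; split => w /=.
    move=> wk; have fin : finite_set [set j | tau j w \in i] by apply/finite_setP; exists k.
    exists (fset_set [set j | tau j w \in i]); split.
      by apply/card_eq_fsetP; rewrite fset_setK.
    by move=> j; rewrite in_fset_set // inE.
  move=> [X [Xk XE]]; rewrite (_ : [set j | _] = [set` X]); first exact/card_eq_fsetP.
  by apply/seteqP; split => j /= /XE.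
apply: measurable_ex => X; apply: measurable_and; first exact: measurable_constant.
apply: measurable_all => j; apply: measurable_iff; last exact: measurable_constant.
exact: measurable_point_itv.
Qed.

Lemma poisson_count (a b : R) k : 0 <= a -> a <= b ->
  P [set w | [set j | tau j w \in `[a, b]] #= `I_k] =
  ((b - a) ^+ k / k`!%:R * expR (- (b - a)))%:E.
Proof.
move=> a0 ab; case: PP => _ _ law.
have mu : lebesgue_measure [set x | x \in `[a, b]] = (b - a)%:E.
  rewrite lebesgue_measure_itv /= lte_fin; case: ltgtP ab => //= ab _.
  by rewrite ab subrr.
have := law 1%N (fun=> [set x | x \in `[a, b]]) (fun=> k).
rewrite big_ord1 mu /= => <-.
- congr (P _); apply/seteqP; split => w /=; first by move=> h _.
  exact: (fun h => h ord0).
- by move=> _; exact: measurable_itv.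
- by move=> _ x /=; rewrite in_itv /= => /andP[ax _]; exact: le_trans ax.
- by move=> _; rewrite ltry.
- by move=> i j _ _ _; rewrite !ord1.
Qed.

Lemma poisson_active_le (a b : R) : 0 <= a -> a <= b ->
  (P [set w | exists j, (a <= tau j w <= b)%R] <= (b - a)%:E)%E.
Proof.
move=> a0 ab.
have -> : [set w | exists j, a <= tau j w <= b] =
    ~` [set w | [set j | tau j w \in `[a, b]] #= `I_0].
  apply/seteqP; split => w /=.
    move=> [j wj]; rewrite II0 card_eq0 => /eqP/seteqP[/(_ j) + _]; apply.
    by rewrite /= in_itv.
  move=> h; apply: contrapT => nj; apply: h; rewrite II0 card_eq0; apply/eqP.
  by apply/seteqP; split => // j /= ; rewrite in_itv /= => wj; apply: nj; exists j.
rewrite probability_setC; last exact: measurable_count.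
rewrite poisson_count // expr0 fact0 divr1 mul1r -EFinB lee_fin.
by rewrite lerBlDr -lerBlDl -[leLHS]/(1 + - (b - a)) expR_ge1Dx.
Qed.

(** Almost surely the points increase, so [tau m w <= n] puts [m+1] of them in [[0, n]]; a Poisson
    variable of mean [n] exceeds [m] with probability at most [exp(-n) * exp(2n) / 2^m]. *)
Lemma poisson_many_le (n m : nat) :
  (P [set w | (tau m w <= n%:R)%R] <= (expR n%:R / 2 ^+ m)%:E)%E.
Proof.
case: PP => _ [N [mN N0 QN]] _.
pose C k := [set w | [set j | tau j w \in `[(0 : R), n%:R]] #= `I_k].
have mC k : measurable (C k) by exact: measurable_count.
have mU : measurable (\big[setU/set0]_(k < m.+1) C k) by exact: bigsetU_measurable.
have PU : P (\big[setU/set0]_(k < m.+1) C k) =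
    (\sum_(k < m.+1) n%:R ^+ k / k`!%:R * expR (- n%:R))%:E.
  rewrite measure_bigsetU_ord //.
    rewrite -sumEFin; apply: eq_bigr => k _.
    by apply: etrans (@poisson_count 0 n%:R k (lexx _) (ler0n _ _)) _; rewrite subr0.
  move=> i j _ _ [w [wi wj]]; have : `I_i #= `I_j by exact: card_eq_trans (card_esym wi) wj.
  by rewrite card_eq_le !card_le_II => /andP[ij ji]; apply/val_inj/eqP; rewrite eqn_leq ij.
have mt : measurable [set w | tau m w <= n%:R].
  have -> : [set w | tau m w <= n%:R] = [set w | tau m w \in `]-oo, n%:R]].
    by apply/seteqP; split => w /=; rewrite in_itv.
  exact: measurable_point_itv.
have sub : [set w | tau m w <= n%:R] `<=` ~` (\big[setU/set0]_(k < m.+1) C k) `|` N.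
  move=> w /= wm; apply: contrapT => /not_orP[] /contrapT.
  rewrite -bigcup_mkord => -[k /= km wk] nN.
  have [t0 tS] : 0 <= tau 0%N w /\ forall j, tau j w < tau j.+1 w.
    by apply: contrapT => nQ; apply: nN; exact: QN.
  have mono i j : (i <= j)%N -> tau i w <= tau j w.
    elim: j => [|j IH]; first by rewrite leqn0 => /eqP ->.
    by rewrite leq_eqVlt => /predU1P[->//|/IH h]; apply: le_trans h (ltW (tS j)).
  have : `I_m.+1 #<= `I_k.
    rewrite -(card_le_eqr wk); apply: subset_card_le => j /= jm; rewrite in_itv /=.
    by rewrite (le_trans t0 (mono _ _ _)) // (le_trans (mono _ _ _) wm).
  by rewrite card_le_II ltnNge -ltnS km.
apply: (@le_trans _ _ (P (~` (\big[setU/set0]_(k < m.+1) C k) `|` N))).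
  by rewrite le_measure ?inE //; apply: measurableU => //; exact: measurableC.
apply: (@le_trans _ _ (P (~` (\big[setU/set0]_(k < m.+1) C k)) + P N)%E).
  by apply: measureU2 => //; exact: measurableC.
have PN : P N = 0%E by exact: N0.
rewrite PN adde0 probability_setC // PU -EFinB lee_fin -mulr_suml expRN.
have := expR_tail_le m (ler0n R n).
have e0 := expR_gt0 (n%:R : R).
rewrite -[_ * n%:R]/(2%:R * n%:R) mulr_natl mulr2n expRD.
set s := \sum_(_ < _) _; set y := expR n%:R in e0 *; move=> h.
rewrite -(ler_pM2r e0) mulrBl mul1r mulfVK ?gt_eqF //.
by rewrite mulrAC lerBlDl; apply: le_trans h _.
Qed.

End poisson.

Section inputs.
Context {R : realType} {disp : measure_display} {T : measurableType disp}.
Variable P : probability T R.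
Context {d : nat} (tau : site d -> nat -> T -> R)
  (S : site d -> nat -> nat -> T -> site d).
Hypothesis inputs : idla_inputs P tau S.

Definition input_index (a : site d + site d * nat) : Prop :=
  match a with inl z => source z | inr zj => source zj.1 end.

Definition input_sigma (a : site d + site d * nat) : set (set T) :=
  match a with
  | inl z => sigma_real (tau z)
  | inr zj => sigma_discrete (S zj.1 zj.2)
  end.

Lemma input_sigma_algebra a : sigma_algebra setT (input_sigma a).
Proof. by case: a => ? /=; exact: smallest_sigma_algebra. Qed.

Lemma input_sigma_measurable a : input_index a -> input_sigma a `<=` measurable.
Proof.
case: inputs => pp srw _; case: a => [z sz|[z j] sz] /=;
    apply: smallest_sub; try exact: sigma_algebra_measurable.
  move=> _ [k [B [mB ->]]]; rewrite -[X in measurable X]setTI.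
  by case: (pp z sz) => mt _ _; exact: mt.
by move=> _ [k [x ->]]; case: (srw z j sz) => mS _ _ _; exact: mS.
Qed.

(** Only the walk of [a] is left out: the point process at [a.1] is included, so the time of [a] is
    measurable for the generated sigma-algebra. *)
Definition other_inputs (a : site d * nat) : set (set T) :=
  [set X | exists i, [/\ input_index i, i != inr a & input_sigma i X]].

Lemma other_inputs_measurable a : <<s other_inputs a >> `<=` measurable.
Proof.
apply: smallest_sub; first exact: sigma_algebra_measurable.
by move=> X [i [ii _]]; exact: input_sigma_measurable.
Qed.

Lemma walk_independent (a : site d * nat) (X E : set T) : source a.1 ->
  <<s other_inputs a >> X -> sigma_discrete (S a.1 a.2) E ->
  P (X `&` E) = (P X * P E)%E.
Proof.
case: inputs => _ _ ind sa oX sE.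
apply: (mutually_independent_generated ind (a := inr a)) => //.
- by move=> i _; exact: input_sigma_algebra.
- by move=> i; exact: input_sigma_measurable.
Qed.

Lemma active_all_le (p : seq (site d)) (a b : R) :
  uniq p -> {in p, forall z, source z} -> 0 <= a -> a <= b ->
  (P [set w | forall z, z \in p -> exists j, (a <= tau z j w <= b)%R] <=
   ((b - a) ^+ size p)%:E)%E.
Proof.
move=> up sp a0 ab; case: inputs => pp _ ind.
pose A (i : site d + site d * nat) : set T :=
  if i is inl z then [set w | exists j, a <= tau z j w <= b] else setT.
have := ind [fset i | i in [seq inl z | z <- p]]%fset A.
rewrite (_ : \bigcap_(i in _) _ =
    [set w | forall z, z \in p -> exists j, (a <= tau z j w <= b)%R]); last first.
  apply/seteqP; split => w /= wA.
    move=> z zp; have := wA (inl z); rewrite /= !inE map_f //; exact.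
  by move=> i /=; rewrite !inE => /mapP[z zp ->] /=; exact: wA.
move=> -> => [|i /=|i].
- rewrite big_imfset //= undup_id ?map_inj_uniq //; last by move=> ? ? [].
  rewrite big_map /=.
  have Pz z : z \in p -> (P [set w | exists j, (a <= tau z j w <= b)%R] <= (b - a)%:E)%E.
    by move=> zp; apply: poisson_active_le => //; apply: pp; exact: sp.
  elim: p Pz {up sp} => [|z p IH] Pz; first by rewrite big_nil expr0.
  rewrite big_cons /= exprS EFinM; apply: lee_pmul => //.
  - by apply: prode_ge0.
  - by apply: Pz; rewrite mem_head.
  - by apply: IH => y yp; apply: Pz; rewrite inE yp orbT.
- by rewrite !inE => /mapP[z zp ->]; exact: sp.
- rewrite !inE => /mapP[z zp ->] /=.
  have -> : [set w | exists j, a <= tau z j w <= b] =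
     \bigcup_j (tau z j @^-1` [set x | x \in `[a, b]]).
    apply/seteqP; split => w /= [j]; first by exists j => //=; rewrite in_itv.
    by rewrite /= in_itv; exists j.
  apply: sigma_algebra_bigcup => j; apply: sub_sigma_algebra.
  by exists j, [set x | x \in `[a, b]]; split => //; exact: measurable_itv.
Qed.
End inputs.

(** * Aggregates along a list of particles *)

Lemma eq_in_sort_rel (T : eqType) (r r' : rel T) (s : seq T) :
  {in s &, r =2 r'} -> sort r s = sort r' s.
Proof.
move=> rr'; have /all_sigP[s' sE] := allss s.
rewrite sE !sort_map; congr map; congr sort.
by apply/funext => x; apply/funext => y; apply: rr'; exact: valP.
Qed.

Notation particle d := (site d * nat)%type.

Section run.
Context {d : nat}.
Implicit Types (s : site d -> nat -> nat -> site d) (l : seq (particle d)).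

Definition run s (A : set (site d)) l : set (site d) :=
  foldl (fun A a => A `|` first_outside A (s a.1 a.2)) A l.

Lemma run_cat s A l1 l2 : run s A (l1 ++ l2) = run s (run s A l1) l2.
Proof. exact: foldl_cat. Qed.

Definition by_time {R : realType} (t : site d -> nat -> R) : rel (particle d) :=
  fun a b => t a.1 a.2 <= t b.1 b.2.

End run.

Section measurable_run.
Context {R : realType} {disp : measure_display} {T : measurableType disp} {d : nat}.
Variables (tau : site d -> nat -> T -> R)
  (S : site d -> nat -> nat -> T -> site d).
Variable ok : pred (particle d).
Hypothesis tau_ok : forall a, ok a -> measurable_fun setT (tau a.1 a.2).
Hypothesis S_ok : forall a, ok a -> forall k x, measurable [set w | S a.1 a.2 k w = x].

Let t w z j := tau z j w.
Let s w z j k := S z j k w.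

(** [ok] selects the particles whose data are measurable for the sigma-algebra put on [T]. Two
    choices are made later: the ambient sigma-algebra, and the one generated by all inputs except
    one walk. *)
Lemma measurable_run l x : all ok l -> measurable [set w | run (s w) set0 l x].
Proof.
elim/last_ind: l x => [|l a IH] x; first by move=> _; exact: measurable_constant.
rewrite all_rcons => /andP[oka okl].
under eq_set do rewrite -cats1 run_cat.
apply: measurable_or; first exact: IH.
have mSA A k : (forall y, measurable [set w | A w y]) ->
    measurable [set w | A w (s w a.1 a.2 k)].
  move=> mA; have -> : [set w | A w (s w a.1 a.2 k)] =
      [set w | exists y, s w a.1 a.2 k = y /\ A w y].
    by apply/seteqP; split => w /=; [exists (s w a.1 a.2 k) | case=> y [->]].
  by apply: measurable_ex => y; apply: measurable_and => //; exact: S_ok.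
apply: measurable_ex => k.
have -> : [set w | [/\ s w a.1 a.2 k = x, ~ run (s w) set0 l x &
     forall i, (i < k)%N -> run (s w) set0 l (s w a.1 a.2 i)]] =
  [set w | s w a.1 a.2 k = x /\ (~ run (s w) set0 l x /\
     forall i, (i < k)%N -> run (s w) set0 l (s w a.1 a.2 i))].
  by apply/seteqP; split => w /=; [case | case=> ? []].
apply: measurable_and; first exact: S_ok.
apply: measurable_and; first by apply: measurable_neg; exact: IH.
apply: measurable_all => i; apply: measurable_impl; first exact: measurable_constant.
by apply: (mSA (fun w => run (s w) set0 l)) => y; exact: IH.
Qed.

Lemma measurable_run_sorted (X : T -> seq (particle d)) x :
  (forall w, all ok (X w)) -> (forall X0, measurable [set w | X w = X0]) ->
  measurable [set w | run (s w) set0 (sort (by_time (t w)) (X w)) x].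
Proof.
move=> okX mX.
have -> : [set w | run (s w) set0 (sort (by_time (t w)) (X w)) x] =
  [set w | exists Xl : seq (particle d) * seq (particle d),
     X w = Xl.1 /\ (sort (by_time (t w)) Xl.1 = Xl.2 /\ run (s w) set0 Xl.2 x)].
  apply/seteqP; split => w /=.
    by exists (X w, sort (by_time (t w)) (X w)).
  by case=> -[X0 l] /= [-> [->]].
apply: measurable_ex => -[X0 l] /=.
have [okX0|nok] := boolP (all ok X0); last first.
  rewrite (_ : [set w | _] = set0) //; apply/seteqP; split => w //= [XE _].
  by have := okX w; rewrite XE (negPf nok).
apply: measurable_and; first exact: mX.
have [lX0|nl] := boolP (perm_eq l X0); last first.
  rewrite (_ : [set w | _] = set0) //; apply/seteqP; split => w //= [sE _].
  by move: nl; rewrite -sE perm_sort perm_refl.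
apply: measurable_and; last by apply: measurable_run; rewrite (perm_all _ lX0).
apply: (@measurable_by_bits _ _ _ _ [seq (a, b) | a <- X0, b <- X0]
   (fun ab w => by_time (t w) ab.1 ab.2) (fun w => sort (by_time (t w)) X0) [set l]).
  move=> [a b] /allpairsP[[a' b'] /= [aX bX [-> ->]]].
  have := measurable_fun_le measurableT (tau_ok (allP okX0 _ aX)) (tau_ok (allP okX0 _ bX)).
  by rewrite setTI.
move=> w w' ww'; apply: eq_in_sort_rel => a b aX bX.
by apply: (ww' (a, b)); exact: allpairs_f.
Qed.

End measurable_run.

Lemma measurable_fset_set {disp : measure_display} {T : measurableType disp}
    (U : countType) (A : T -> set U) (Y : {fset U}) :
  (forall u, measurable [set w | A w u]) -> measurable [set w | fset_set (A w) = Y].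
Proof.
move=> mA.
have mAY (Z : {fset U}) : measurable [set w | forall u, A w u <-> u \in Z].
  apply: measurable_all => u; apply: measurable_iff => //.
  exact: measurable_constant.
have AE w (Z : {fset U}) : (forall u, A w u <-> u \in Z) <-> A w = [set` Z].
  by split => [h|-> u //]; apply/seteqP; split => u /= /h.
(* [fset_set] takes the value [fset0] on infinite sets, whence the second alternative. *)
have -> : [set w | fset_set (A w) = Y] = [set w | (forall u, A w u <-> u \in Y) \/
    (Y = fset0 /\ ~ exists Z : {fset U}, forall u, A w u <-> u \in Z)].
  apply/seteqP; split => w /=.
    have [fA <-|fA] := pselect (finite_set (A w)).
      by left; apply/AE; rewrite fset_setK.
    rewrite /fset_set; case: pselect => // _ <-; right; split => //.
    by case=> Z /AE AZ; apply: fA; rewrite AZ; exact: finite_fset.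
  case=> [/AE ->|[-> nZ]]; first by rewrite set_fsetK.
  rewrite /fset_set; case: pselect => // fA; exfalso; apply: nZ.
  by exists (fset_set (A w)); apply/AE; rewrite fset_setK.
apply: measurable_or => //; apply: measurable_and; first exact: measurable_constant.
by apply: measurable_neg; apply: measurable_ex.
Qed.

Section measurable_aggregates.
Context {R : realType} {disp : measure_display} {T : measurableType disp}.
Variable P : probability T R.
Context {d : nat} (n : nat) (tau : site d -> nat -> T -> R)
  (S : site d -> nat -> nat -> T -> site d).
Hypothesis inputs : idla_inputs P tau S.

Let t w z j := tau z j w.
Let s w z j k := S z j k w.

Lemma measurable_tau z j : source z -> measurable_fun setT (tau z j).
Proof. by case: inputs => pp _ _ /pp[]. Qed.

Lemma measurable_S z j k x : source z -> measurable [set w | S z j k w = x].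
Proof. by case: inputs => _ srw _ sz; case: (srw z j sz) => mS _ _ _; exact: mS. Qed.

Lemma measurable_tau_itv z j (i : interval R) : source z ->
  measurable [set w | tau z j w \in i].
Proof.
move=> sz; have := measurable_tau j sz measurableT (measurable_itv i).
by rewrite setTI.
Qed.

Lemma measurable_aggregate M x : measurable [set w | aggregate n (t w) (s w) M x].
Proof.
apply: (@measurable_run_sorted R _ _ _ tau S (fun a => `[< source a.1 >]) _ _
  (fun w => enum_fset (fset_set (arrivals n (t w) M)))).
- by move=> a /asboolP sa; exact: measurable_tau.
- by move=> a /asboolP sa k y; exact: measurable_S.
- move=> w; apply/allP => a; rewrite /fset_set; case: pselect => // fA.
  case: cid => Y /= YE aY; apply/asboolP.
  have : [set` Y] a by exact: aY.
  by rewrite -YE => -[].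
- move=> X0; have -> : [set w | enum_fset (fset_set (arrivals n (t w) M)) = X0] =
      [set w | exists Y : {fset particle d},
        fset_set (arrivals n (t w) M) = Y /\ enum_fset Y = X0].
    by apply/seteqP; split => w /=; [exists (fset_set (arrivals n (t w) M)) | case=> Y [->]].
  apply: measurable_ex => Y; apply: measurable_and; last exact: measurable_constant.
  apply: (@measurable_fset_set _ _ _ (fun w => arrivals n (t w) M)) => a.
  have [sa|nsa] := pselect (source a.1); last first.
    by rewrite (_ : [set w | _] = set0) //; apply/seteqP; split => w // [].
  have -> : [set w | arrivals n (t w) M a] =
      [set w | cylinder M a.1 /\ tau a.1 a.2 w \in `[0, n%:R]].
    by apply/seteqP; split => w /=; rewrite in_itv /= => -[].
  apply: measurable_and; first exact: measurable_constant.
  exact: measurable_tau_itv.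
Qed.

Lemma measurable_stabilized M : measurable
  [set w | aggregate_oo n (t w) (s w) `&` cylinder M =
           aggregate n (t w) (s w) (2 * M) `&` cylinder M].
Proof.
have -> : [set w | aggregate_oo n (t w) (s w) `&` cylinder M =
           aggregate n (t w) (s w) (2 * M) `&` cylinder M] =
   [set w | forall x, ((exists N, aggregate n (t w) (s w) N x) /\ cylinder M x) <->
       (aggregate n (t w) (s w) (2 * M) x /\ cylinder M x)].
  apply/seteqP; split => w /=.
    move=> /seteqP[h1 h2] x; split => [[[N xN] xM]|[x1 x2]].
      by apply: h1; split => //; exists N.
    by have [[N _ xN] xM] := h2 x (conj x1 x2); split => //; exists N.
  move=> h; apply/seteqP; split => x [].
    by move=> [N _ xN] xM; apply/h; split => //; exists N.
  by move=> x1 x2; have /h[[N xN] xM] := conj x1 x2; split => //; exists N.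
apply: measurable_all => x; apply: measurable_iff; apply: measurable_and;
  rewrite ?measurable_aggregate //; try exact: measurable_constant.
  by apply: measurable_ex => N; exact: measurable_aggregate.
exact: measurable_aggregate.
Qed.

(** The comparison with the time of [a] is strict, which keeps [a] itself out of the list. *)
Definition earlier (Pl : seq (particle d)) (a : particle d)
    (t : site d -> nat -> R) : seq (particle d) :=
  [seq b <- Pl | [&& 0 <= t b.1 b.2, t b.1 b.2 <= n%:R & t b.1 b.2 < t a.1 a.2]].

(** The cluster met by [a] is a function of the other inputs, hence independent of the walk of
    [a]. *)
Lemma earlier_measurable Pl a x : source a.1 -> {in Pl, forall b, source b.1} ->
  <<s other_inputs tau S a >>
    [set w | run (s w) set0 (sort (by_time (t w)) (earlier Pl a (t w))) x].
Proof.
move=> sa sPl.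
pose T' := g_sigma_algebraType (other_inputs tau S a).
have mt z j : source z -> measurable_fun (setT : set T') (tau z j).
  move=> sz _ B mB; rewrite setTI; apply: sub_sigma_algebra.
  exists (inl z); split => //=; apply: sub_sigma_algebra.
  by exists j, B.
have mS b : source b.1 -> b != a -> forall k y,
    measurable ([set w | S b.1 b.2 k w = y] : set T').
  move=> sb ba k y; apply: sub_sigma_algebra; exists (inr b); split => //=.
  by apply: sub_sigma_algebra; exists k, y.
apply: (@measurable_run_sorted R _ T' _ tau S
  (fun b => `[< source b.1 >] && (b != a)) _ _ (fun w => earlier Pl a (t w))).
- by move=> b /andP[/asboolP sb _]; exact: mt.
- by move=> b /andP[/asboolP sb ba]; exact: mS.
- move=> w; apply/allP => b; rewrite mem_filter => /andP[/and3P[_ _ tba] bPl].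
  apply/andP; split; first by apply/asboolP; exact: sPl.
  by apply: contraTneq tba => ->; rewrite ltxx.
- move=> X0.
  apply: (@measurable_by_bits _ T' _ _ Pl
    (fun b w => [&& 0 <= t w b.1 b.2, t w b.1 b.2 <= n%:R & t w b.1 b.2 < t w a.1 a.2])
    (fun w => earlier Pl a (t w)) [set X0]).
    move=> b /sPl sb.
    have -> : [set w : T' | [&& 0 <= t w b.1 b.2, t w b.1 b.2 <= n%:R & t w b.1 b.2 < t w a.1 a.2]] =
      (tau b.1 b.2 @^-1` [set` `[0, n%:R]]) `&` ~` [set w | tau a.1 a.2 w <= tau b.1 b.2 w].
      apply/seteqP; split => w /=; rewrite in_itv /=.
        by move=> /and3P[-> -> ab]; split => //; apply/negP; rewrite -ltNge.
      by move=> [/andP[-> ->] /negP]; rewrite -ltNge.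
    apply: measurableI.
      by have := mt b.1 b.2 sb measurableT _ (measurable_itv `[0, n%:R]); rewrite setTI.
    apply: measurableC.
    have := measurable_fun_le measurableT (mt a.1 a.2 sa) (mt b.1 b.2 sb).
    by rewrite setTI.
  by move=> w w' ww'; apply: eq_in_filter => b bPl; exact: ww'.
Qed.

End measurable_aggregates.

(** * Boxes of sites and sources *)

Section geometry.
Context {d : nat}.
Implicit Types x y z : site d.

Lemma near_refl r x : near r x x.
Proof. by apply/forallP => i; rewrite subrr normr0. Qed.

Lemma near_sym r x y : near r x y = near r y x.
Proof. by apply: eq_forallb => i; rewrite distrC. Qed.

Lemma near_trans y r s x z : near r x y -> near s y z -> near (r + s) x z.
Proof.
move=> /forallP xy /forallP yz; apply/forallP => i.
by apply: le_trans (ler_distD (y 0 i) _ _) _; rewrite PoszD lerD.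
Qed.

Lemma cylinder_near r s x z : cylinder r z -> near s x z -> cylinder (r + s) x.
Proof.
move=> cz /forallP xz i i0; have := xz i; have := cz i i0; lia.
Qed.

Lemma cylinder_le r s x : (r <= s)%N -> cylinder r x -> cylinder s x.
Proof. by move=> rs cx i i0; apply: le_trans (cx i i0) _; rewrite lez_nat. Qed.

Definition ball_vec (r : nat) (f : {ffun 'I_d -> 'I_(2 * r).+1}) : site d :=
  \row_i ((f i)%:Z - r%:Z).

Definition ball (r : nat) (z : site d) : {fset site d} :=
  [fset (z + ball_vec f)%R | f in {: {ffun 'I_d -> 'I_(2 * r).+1}}]%fset.

Lemma near_ball r x z : near r x z -> x \in ball r z.
Proof.
move=> /forallP xz; apply/imfsetP => /=.
exists [ffun i => inord `|(x 0 i - z 0 i + r%:Z)%R|%N] => //.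
apply/rowP => i; rewrite !mxE ffunE; have := xz i.
move: (x 0 i) (z 0 i) => a b ab; rewrite inordK; lia.
Qed.

Definition source_vec (r : nat) (f : {ffun 'I_d.-1 -> 'I_(2 * r).+1}) : site d :=
  \row_i (if (i : nat) is i'.+1 then
    (if insub i' is Some j then (f j)%:Z - r%:Z else 0) else 0).

Definition source_box (r : nat) : seq (site d) :=
  [seq source_vec f | f <- enum {: {ffun 'I_d.-1 -> 'I_(2 * r).+1}}].

Lemma size_source_box r : size (source_box r) = ((2 * r).+1 ^ d.-1)%N.
Proof. by rewrite size_map -cardE card_ffun !card_ord. Qed.

Let lift_ord (j : 'I_d.-1) : 'I_d.
Proof. by apply: (@Ordinal d j.+1); rewrite -ltn_predRL. Defined.

Lemma source_boxP r x : reflect (source x /\ cylinder r x) (x \in source_box r).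
Proof.
apply: (iffP mapP) => [[f _ ->]|[sx cx]].
  split => -[[|i] id] //=; rewrite mxE /= // => _.
  case: insubP => [j _ jE|_]; last by rewrite normr0.
  by move: (f j) => k; have := ltn_ord k; move: (k : nat) => {}k; lia.
exists [ffun j : 'I_d.-1 => inord `|(x 0 (lift_ord j) + r%:Z)%R|%N].
  by rewrite mem_enum.
apply/rowP => i; rewrite mxE.
case iE : (i : nat) => [|i']; first by apply: sx.
have id : (i' < d.-1)%N by rewrite ltn_predRL -iE.
rewrite insubT ffunE /=.
have -> : lift_ord (Sub i' id) = i by apply/val_inj; rewrite /= iE.
have : `|x 0 i| <= r%:Z by apply: cx; rewrite iE.
move: (x 0 i) => a ar.
rewrite inordK; lia.
Qed.

Lemma source_box_uniq r : uniq (source_box r).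
Proof.
rewrite map_inj_uniq ?enum_uniq // => f g /rowP fg; apply/ffunP => j.
have := fg (lift_ord j); rewrite !mxE /=.
case: insubP => [k _ kj|]; last by rewrite ltn_ord.
by have -> : k = j by [apply/val_inj]; move=> /addIr [] /val_inj.
Qed.

Lemma near_source_box r x z : source x -> source z -> near r x z ->
  x - z \in source_box r.
Proof.
move=> sx sz /forallP xz; apply/source_boxP; split => i i0; rewrite !mxE.
  by rewrite sx // sz // subr0.
exact: xz.
Qed.

End geometry.

(** * A walk confined to the earlier cluster *)

Lemma sum_disjoint_le1 {R : realType} {disp : measure_display}
    {T : measurableType disp} (P : probability T R) (I : eqType) (s : seq I)
    (A : I -> set T) : uniq s -> (forall i, i \in s -> measurable (A i)) ->
  (forall i j w, i \in s -> j \in s -> A i w -> A j w -> i = j) ->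
  (\sum_(i <- s) P (A i) <= 1)%E.
Proof.
move=> us mA dA.
suff [mU <-] : measurable [set w | exists2 i, i \in s & A i w] /\
    P [set w | exists2 i, i \in s & A i w] = (\sum_(i <- s) P (A i))%E.
  exact: probability_le1 mU.
elim: s us mA dA => [|i s IH] /= us mA dA.
  rewrite (_ : [set w | _] = set0); last by apply/seteqP; split => w // [].
  by rewrite big_nil measure0; split; first exact: measurable0.
have /andP[ins us'] := us.
have mAi := mA i (mem_head _ _).
have [|||ms Ps] := IH; rewrite ?us' //.
- by move=> j js; apply: mA; rewrite inE js orbT.
- by move=> j k w js ks; apply: dA; rewrite inE ?js ?ks orbT.
rewrite (_ : [set w | _] = A i `|` [set w | exists2 i, i \in s & A i w]); last first.
  apply/seteqP; split => w /=.
    by move=> [j]; rewrite inE => /predU1P[->|js]; [left | right; exists j].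
  by move=> [Aiw|[j js Ajw]]; [exists i; rewrite ?mem_head | exists j => //; rewrite inE js orbT].
split; first exact: measurableU.
rewrite big_cons -Ps; apply: measureU => //.
apply/seteqP; split => w //= [Aiw [j js Ajw]].
by move: ins; rewrite (dA i j w) ?js // inE ?eqxx ?js ?orbT.
Qed.

Section stuck.
Context {R : realType} {disp : measure_display} {T : measurableType disp}.
Variable P : probability T R.
Context {d : nat} (n : nat) (tau : site d -> nat -> T -> R)
  (S : site d -> nat -> nat -> T -> site d).
Hypothesis inputs : idla_inputs P tau S.

Let t w z j := tau z j w.
Let s w z j k := S z j k w.

Definition cluster_before Pl a w : set (site d) :=
  run (s w) set0 (sort (by_time (t w)) (earlier n Pl a (t w))).

Variables (Pl : seq (particle d)) (a : particle d).
Hypotheses (sPl : {in Pl, forall b, source b.1}) (sa : source a.1).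

Let M := cluster_before Pl a.

Lemma cluster_before_measurable x : measurable [set w | M w x].
Proof.
by apply: (other_inputs_measurable inputs (a := a)); exact: earlier_measurable.
Qed.

(** The volume bound belongs to the event, so that the probability can be estimated with no a priori
    knowledge of the cluster. *)
Definition stuck (V r N : nat) (w : T) : Prop :=
  (exists X : seq (site d), (size X <= V)%N /\
     forall x, near r x a.1 -> M w x -> x \in X) /\
  forall i, (i <= N)%N -> near r (S a.1 a.2 i w) a.1 /\ M w (S a.1 a.2 i w).

Lemma stuck_measurable V r N : measurable [set w | stuck V r N w].
Proof.
apply: measurable_and.
  apply: measurable_ex => X; apply: measurable_and; first exact: measurable_constant.
  apply: measurable_all => x; apply: measurable_impl; first exact: measurable_constant.
  apply: measurable_impl; last exact: measurable_constant.
  exact: cluster_before_measurable.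
apply: measurable_all => i; apply: measurable_impl; first exact: measurable_constant.
have -> : [set w | near r (S a.1 a.2 i w) a.1 /\ M w (S a.1 a.2 i w)] =
    [set w | exists x, S a.1 a.2 i w = x /\ (near r x a.1 /\ M w x)].
  by apply/seteqP; split => w /=; [exists (S a.1 a.2 i w) | case=> x [->]].
apply: measurable_ex => x; apply: measurable_and; first exact: measurable_S inputs _ _ _ _ sa.
apply: measurable_and; first exact: measurable_constant.
exact: cluster_before_measurable.
Qed.

(* The cluster met by the walk [a] is independent of that walk, so one may
   condition on its trace in the ball. *)
Lemma stuck_le (hd : (0 < d)%N) V r u k : (0 < u)%N ->
  (2 * (V * (d ^ d).+1) <= u ^ d)%N ->
  (P [set w | stuck V r (k * u ^ 2) w] <= ((2 ^ k)%:R^-1)%:E)%E.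
Proof.
move=> u0 Vu; set N := (k * u ^ 2)%N.
pose D := [fset x in ball r a.1 | near r x a.1]%fset.
(* [L] lists the possible traces of the cluster in the ball. The events [A B] that the trace is [B]
   are disjoint and depend on the other inputs; [E B] concerns the walk alone and has probability at
   most [2^-k]. Summing [P (A B) * P (E B)] over [L] gives the bound. *)
pose L : seq {fset site d} := [seq B <- enum_fset (fpowerset D) | (size (enum_fset B) <= V)%N].
pose A (B : {fset site d}) := [set w | forall x, near r x a.1 -> M w x <-> x \in B].
pose E (B : {fset site d}) := [set w | forall i, (i <= N)%N -> S a.1 a.2 i w \in B].
have oA B : <<s other_inputs tau S a >> (A B).
  apply: (@measurable_all _ (g_sigma_algebraType (other_inputs tau S a))) => x.
  apply: measurable_impl; first exact: measurable_constant.
  apply: measurable_iff; last exact: measurable_constant.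
  exact: earlier_measurable.
have sE B : sigma_discrete (S a.1 a.2) (E B).
  pose T' := g_sigma_algebraType [set A | exists k x, A = S a.1 a.2 k @^-1` [set x]].
  apply: (@measurable_all _ T') => i.
  apply: measurable_impl; first exact: measurable_constant.
  apply: (@measurable_preimage_countable _ T' _ (S a.1 a.2 i) (fun x => x \in B)) => x.
  by apply: sub_sigma_algebra; exists i, x.
have mA B : measurable (A B) by exact: (other_inputs_measurable inputs (oA B)).
have mE B : measurable (E B) by exact: (input_sigma_measurable inputs (a := inr a) sa (sE B)).
have EB (B : {fset site d}) : B \in L -> (P (E B) <= ((2 ^ k)%:R^-1)%:E)%E.
  rewrite mem_filter => /andP[BV _].
  have [_ srw _] := inputs.
  apply: le_trans (confined_walk_le hd (srw a.1 a.2 sa) (X := enum_fset B) (u := u) k u0 _).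
    by [].
  by apply: leq_trans Vu; rewrite leq_mul2l leq_mul2r BV orbT.
have c0 : 0 <= (2 ^ k)%:R^-1 :> R by rewrite invr_ge0.
apply: le_trans (union_bound P (s := L) (A := fun B => A B `&` E B) _ _ _) _.
- exact: stuck_measurable.
- by move=> B _; exact: measurableI.
- move=> w [[X [XV MX]] Sw].
  pose B := [fset x in D | `[< near r x a.1 /\ M w x >]]%fset.
  have BE x : x \in B <-> near r x a.1 /\ M w x.
    rewrite !inE /=; split=> [/andP[_ /asboolP]//|h].
    have [h1 h2] := h; rewrite (near_ball h1) h1 /=; apply/asboolP; split => //; exact: h2.
  exists B; last first.
    split; first by move=> x xa; split => [Mx|/BE[]//]; apply/BE.
    by move=> i iN; apply/BE; exact: Sw.
  rewrite mem_filter; apply/andP; split.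
    apply: leq_trans XV; apply: uniq_leq_size; first exact: fset_uniq.
    by move=> x /BE[xa Mx]; exact: MX.
  by rewrite fpowersetE; apply/fsubsetP => x; rewrite !inE => /andP[].
apply: (@le_trans _ _ (\sum_(B <- L) P (A B) * ((2 ^ k)%:R^-1)%:E)%E).
  rewrite !big_seq; apply: lee_sum => B BL.
  rewrite (walk_independent inputs sa (oA B) (sE B)).
  by apply: lee_wpmul2l; [exact: measure_ge0 | exact: EB].
rewrite -ge0_sume_distrl; last by move=> B _; exact: measure_ge0.
rewrite -[leRHS]mul1e; apply: lee_wpmul2r; first by rewrite lee_fin.
apply: sum_disjoint_le1 => //; first by apply: filter_uniq; exact: fset_uniq.
move=> B B' w; rewrite !mem_filter !fpowersetE => /andP[_ /fsubsetP BD] /andP[_ /fsubsetP BD'].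
move=> AB AB'; apply/fsetP => x; apply/idP/idP => xB.
  have /andP[_ xa] : (x \in ball r a.1) && near r x a.1 by have := BD x xB; rewrite !inE.
  by apply/(AB' x xa)/(AB x xa).
have /andP[_ xa] : (x \in ball r a.1) && near r x a.1 by have := BD' x xB; rewrite !inE.
by apply/(AB x xa)/(AB' x xa).
Qed.

End stuck.

(** * Propagation of discrepancies *)

Section deterministic.
Context {d : nat} (s : site d -> nat -> nat -> site d).
Implicit Types (A : set (site d)) (l : seq (particle d)) (a : particle d).
Implicit Types (x y z : site d).

Definition leaves r A a : Prop := exists k,
  ~ A (s a.1 a.2 k) /\ forall i, (i <= k)%N -> near r (s a.1 a.2 i) a.1.

Lemma leavesS r A A' a : A' `<=` A -> leaves r A a -> leaves r A' a.
Proof. by move=> AA' [k [Ak nk]]; exists k; split => // /AA'. Qed.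

Lemma leaves_first_outside r A a : leaves r A a -> exists x,
  [/\ first_outside A (s a.1 a.2) = [set x], ~ A x & near r x a.1].
Proof.
move=> [k [Ak nk]].
have exk : exists k, `[< ~ A (s a.1 a.2 k) >] by exists k; apply/asboolP.
pose m := ex_minn exk; have [mA mmin] : ~ A (s a.1 a.2 m) /\
    forall j, ~ A (s a.1 a.2 j) -> (m <= j)%N.
  rewrite /m; case: ex_minnP => j /asboolP Aj jmin; split => // i Ai.
  by apply: jmin; apply/asboolP.
exists (s a.1 a.2 m); split => //; last by apply: nk; exact: mmin.
apply/seteqP; split => x /=.
  move=> [j [<- Aj jA]]; congr (s _ _ _); apply/eqP; rewrite eqn_leq mmin // andbT.
  by rewrite leqNgt; apply/negP => /jA.
move=> ->; exists m; split => // i im; apply: contrapT => /mmin.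
by rewrite leqNgt im.
Qed.

Fixpoint settles r A l : Prop :=
  if l is a :: l' then
    leaves r A a /\ settles r (A `|` first_outside A (s a.1 a.2)) l'
  else True.

Lemma settlesP r A l : settles r A l <->
  forall l1 a l2, l = l1 ++ a :: l2 -> leaves r (run s A l1) a.
Proof.
elim: l A => [|a l IH] A /=.
  by split => // _ [|? ?] ? ? //.
split => [[la /IH sl] [|b l1] c l2 /=|h].
- by move=> [<- _].
- by move=> [<- lE]; exact: sl lE.
- split; first exact: (h [::] a l).
  by apply/IH => l1 b l2 lE; apply: (h (a :: l1) b l2); rewrite lE.
Qed.

(** If the exit point from [A'] is not in [A], it is the exit point from [A] too, since the walk was
    in [A'], hence in [A], until then. *)
Lemma first_outside_subset A A' (p : nat -> site d) : A' `<=` A ->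
  first_outside A' p `<=` A `|` first_outside A p.
Proof.
move=> AA' x [k [<- A'x xA']]; have [Ax|Ax] := pselect (A (p k)); first by left.
by right; exists k; split => // i /xA'/AA'.
Qed.

Lemma run_subset (pf : pred (particle d)) A A' l : A' `<=` A ->
  run s A' (seq.filter pf l) `<=` run s A l.
Proof.
elim: l A A' => [|a l IH] A A' AA' //=; case: (pf a) => /=; apply: IH.
  move=> x [/AA'|/(first_outside_subset AA')]; [by left | by []].
by move=> x /AA'; left.
Qed.

(** Each particle adds one entry to [X], within [r] of its source, so the entries within [r'] of [z]
    are charged to particles starting within [r' + r] of [z]. *)
Lemma run_volume r A l : settles r A l -> exists X : seq (site d),
  run s A l `<=` A `|` [set` X] /\
  forall r' z, (count (near r' z) X <= count (fun a => near (r' + r) z a.1) l)%N.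
Proof.
elim: l A => [|a l IH] A /=; first by exists [::]; split => // x; left.
move=> [/leaves_first_outside [x [xE Ax xa]] /IH[X [XA Xc]]].
exists (x :: X); split => [y /XA[[Ay|]|yX]|r' z].
- by left.
- by rewrite xE => ->; right; rewrite /= mem_head.
- by right; rewrite /= inE yX orbT.
- rewrite /=; apply: leq_add => //.
  by case: (boolP (near r' z x)) => // zx; rewrite (near_trans zx xa).
Qed.

Section discrepancy.
Variables (rho : nat) (front : nat -> nat) (active : nat -> pred (site d)).

Definition seed i z := exists y, ~ cylinder (front i) y /\ near rho y z.

(** The chains along which a discrepancy can have entered the front during slot [i]. Their sources
    are distinct, so that the activities of these sources are independent. *)
Definition reach i z := exists p : seq (site d),
  [/\ uniq (z :: p), path (near (2 * rho)%N) z p, all (active i) (z :: p) &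
      seed i (last z p)].

(** The new source is put at the head of the chain; if it already occurs there, the chain is cut so
    as to start from that occurrence. *)
Lemma reach_step i z z' : active i z' -> near (2 * rho)%N z' z ->
  reach i z -> reach i z'.
Proof.
move=> az' z'z [p [up pp ap sp]].
have [zz'|zz'] := eqVneq z' z; first by rewrite zz'; exists p.
have [z'p|z'p] := boolP (z' \in p); last first.
  exists (z :: p); split => //=; last by rewrite -/(all _ (z :: p)) az' ap.
  - by rewrite -/(uniq (z :: p)) up inE negb_or zz' z'p.
  - by rewrite z'z.
case/splitPr: p / z'p up pp ap sp => p1 p2 up pp ap sp; exists p2; split.
- by move: up; rewrite /= cat_uniq => /andP[_ /and3P[]].
- by move: pp; rewrite cat_path /= => /and3P[].
- by move: ap; rewrite /= all_cat /= => /and3P[_ _ /andP[-> ->]].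
- by move: sp; rewrite last_cat.
Qed.

Definition discrepancy i (A A' : set (site d)) := forall x, A x -> ~ A' x ->
  ~ cylinder (front i) x \/ exists z, reach i z /\ near rho x z.

Lemma path_near r z p : path (near r) z p -> near (size p * r) z (last z p).
Proof.
elim: p z => [|y p IH] z /=; first by rewrite mul0n near_refl.
by move=> /andP[zy /IH yp]; rewrite mulSn; exact: near_trans zy yp.
Qed.

Variable I : nat.
Hypothesis front_nincr : forall i, (front i.+1 <= front i)%N.
Hypothesis reach_front : forall i z x, (i <= I)%N -> reach i z -> near rho x z ->
  ~ cylinder (front i.+1) x.

(** By [reach_front], a discrepancy explained by a chain in slot [i] lies outside the front of slot
    [i+1]. At a change of slot the chains can therefore be forgotten, and new ones start from the
    front. *)
Lemma discrepancy_le i j A A' : (i <= j <= I)%N ->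
  discrepancy i A A' -> discrepancy j A A'.
Proof.
move=> /andP[ij jI] D x Ax A'x.
have mono k m : (k <= m)%N -> (front m <= front k)%N.
  elim: m => [|m IH]; first by rewrite leqn0 => /eqP ->.
  by rewrite leq_eqVlt => /predU1P[->//|/IH]; apply: leq_trans.
have [ij'|ij'] := eqVneq i j; first by rewrite -ij'; exact: D.
have {}ij : (i < j)%N by rewrite ltn_neqAle ij'.
left; case: (D x Ax A'x) => [h|[z [iz xz]]]; move=> /cylinder_le => c.
  by apply: h; apply: c; exact: mono (ltnW ij).
apply: (reach_front _ iz xz); first exact: leq_trans (ltnW ij) jI.
by apply: c; exact: mono.
Qed.

Variables (sigma : particle d -> nat) (pf : pred (particle d)).

(** If [a] takes part in both runs and settles at [x] in one and at [x'] in the other, with [x]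
    distinct from [x'], then [x'] was an earlier discrepancy within [rho] of [a.1], and its chain is
    extended by [a.1]. If [a] takes part in the larger run only, its source lies outside the front
    and is a chain by itself. *)
Lemma discrepancy_step a A A' : settles rho A [:: a] -> A' `<=` A ->
  active (sigma a) a.1 -> (~~ pf a -> ~ cylinder (front (sigma a)) a.1) ->
  discrepancy (sigma a) A A' ->
  discrepancy (sigma a) (A `|` first_outside A (s a.1 a.2))
    (run s A' (seq.filter pf [:: a])).
Proof.
move=> [la _] AA' act nf D.
have [x [xE Ax xa]] := leaves_first_outside la.
have reach_a y : seed (sigma a) a.1 \/ (A y /\ ~ A' y /\ near rho y a.1) ->
    exists z, reach (sigma a) z /\ near rho x z.
  move=> h; exists a.1; split => //; case: h => [sa|[Ay [A'y ya]]].
    by exists [::]; split => //=; rewrite act.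
  case: (D y Ay A'y) => [cy|[z [iz yz]]].
    by exists [::]; split => //=; [rewrite act | exists y].
  apply: reach_step iz => //; rewrite mul2n -addnn; apply: near_trans yz.
  by rewrite near_sym.
rewrite xE; case: (boolP (pf a)) => [pa|pa] /=; rewrite ?pa ?(negPf pa) /=.
  have [x' [x'E A'x' x'a]] := leaves_first_outside (leavesS AA' la).
  rewrite x'E => y [Ay|/= ->] nA'y.
    by apply: D => // A'y; apply: nA'y; left.
  right; apply: (reach_a x'); right.
  have : (A `|` first_outside A (s a.1 a.2)) x'.
    by apply: (first_outside_subset AA'); rewrite x'E.
  rewrite xE => -[Ax'|/= x'x]; first by split.
  by exfalso; apply: nA'y; right => /=.
move=> y [Ay|/= ->] nA'y; first exact: D.
right; apply: (reach_a x); left; exists a.1; split; [exact: nf | exact: near_refl].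
Qed.

Lemma run_discrepancy i0 l A A' : settles rho A l -> A' `<=` A ->
  path leq i0 (map sigma l) -> (i0 <= I)%N ->
  (forall a, a \in l -> [/\ (sigma a <= I)%N, active (sigma a) a.1 &
     ~~ pf a -> ~ cylinder (front (sigma a)) a.1]) ->
  discrepancy i0 A A' ->
  exists2 i, (i <= I)%N & discrepancy i (run s A l) (run s A' (seq.filter pf l)).
Proof.
elim: l i0 A A' => [|a l IH] i0 A A' /=; first by move=> _ _ _ i0I _ D; exists i0.
move=> [la sl] AA' /andP[i0a pl] i0I hl D.
have [aI act nf] := hl a (mem_head _ _).
have Da : discrepancy (sigma a) A A' by apply: discrepancy_le D; rewrite i0a.
have step := discrepancy_step (conj la Logic.I) AA' act nf Da.
have -> : run s A' (if pf a then a :: seq.filter pf l else seq.filter pf l) =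
    run s (run s A' (seq.filter pf [:: a])) (seq.filter pf l).
  by rewrite /=; case: (pf a).
apply: IH sl _ pl aI _ step => [|b bl]; last by apply: hl; rewrite inE bl orbT.
exact: (run_subset (l := [:: a])).
Qed.

End discrepancy.

(* The slots are so short that active sources form no long chains, whence the
   front recedes by a bounded amount during a slot. *)
Lemma reach_recedes rho front active m I :
  (forall i, (i <= I)%N -> (front i.+1 + 2 * rho * m.+1 <= front i)%N) ->
  (forall i z p, (i <= I)%N -> uniq (z :: p) -> path (near (2 * rho)%N) z p ->
     all (active i) (z :: p) -> size p = m -> False) ->
  forall i z x, (i <= I)%N -> reach rho front active i z -> near rho x z ->
    ~ cylinder (front i.+1) x.
Proof.
move=> fr nolong i z x iI [p [up pp ap [y [cy yl]]]] xz cx; apply: cy.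
(* A longer chain would contain one of exactly [m+1] sources, which [nolong] excludes. *)
have pm : (size p < m)%N.
  rewrite ltnNge; apply/negP => mp.
  apply: (nolong i z (take m p) iI); last by rewrite size_takel.
  - by move: up; rewrite -[in z :: p](cat_take_drop m p) -cat_cons cat_uniq => /and3P[].
  - by move: pp; rewrite -[p in path _ _ p](cat_take_drop m p) cat_path => /andP[].
  - by move: ap; rewrite -[in z :: p](cat_take_drop m p) -cat_cons all_cat => /andP[].
apply: cylinder_le (fr i iI) _.
have h : near (rho + (size p * (2 * rho) + rho)) x y.
  apply: near_trans xz _; apply: near_trans (path_near pp) _.
  by rewrite near_sym.
apply: (@cylinder_le _ (front i.+1 + (rho + (size p * (2 * rho) + rho)))).
  rewrite leq_add2l; nia.
by apply: cylinder_near cx _; rewrite near_sym.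
Qed.

End deterministic.

(** * Descent of the settling radius *)

Section particles.
Context {d : nat}.
Implicit Types (l : seq (particle d)) (a : particle d).

(** A deterministic list for the union bounds. It contains all arrivals from [H_N] once no source
    there has more than [q] points up to time [n]; using the scale [q] as this cap costs a
    probability of order [2^-q] per source. *)
Definition particles (N q : nat) : seq (particle d) :=
  [seq (z, j) | z <- source_box N, j <- iota 0 q].

Lemma mem_particles N q a :
  (a \in particles N q) = (a.1 \in source_box N) && (a.2 < q)%N.
Proof.
apply/allpairsP/andP => [[[z j] /= [zN]]|[aN aq]].
  by rewrite mem_iota => jq ->.
by exists a; rewrite mem_iota; split => //; case: a {aN aq}.
Qed.

Lemma particles_source N q a : a \in particles N q -> source a.1.
Proof. by rewrite mem_particles => /andP[/source_boxP[]]. Qed.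

Lemma size_particles N q : size (particles N q) = ((2 * N).+1 ^ d.-1 * q)%N.
Proof. by rewrite size_allpairs size_source_box size_iota. Qed.

Lemma count_near_particles N q r l z : uniq l -> {subset l <= particles N q} ->
  source z -> (count (fun a => near r z a.1) l <= (2 * r).+1 ^ d.-1 * q)%N.
Proof.
move=> ul lP sz; rewrite -size_filter.
have <- : size [seq (z + v, j) | v <- source_box r, j <- iota 0 q] =
    ((2 * r).+1 ^ d.-1 * q)%N by rewrite size_allpairs size_source_box size_iota.
apply: uniq_leq_size; first exact: filter_uniq.
move=> a; rewrite mem_filter near_sym => /andP[az /lP].
rewrite mem_particles => /andP[/source_boxP[sa _] aq].
apply/allpairsP; exists (a.1 - z, a.2) => /=; split.
- exact: near_source_box.
- by rewrite mem_iota.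
- by rewrite addrC subrK; case: (a).
Qed.

Variable s : site d -> nat -> nat -> site d.

Lemma local_volume N q r r' l z : settles s r' set0 l -> uniq l ->
  {subset l <= particles N q} -> source z ->
  exists X : seq (site d), (size X <= (2 * (r + r')).+1 ^ d.-1 * q)%N /\
    forall x, near r x z -> run s set0 l x -> x \in X.
Proof.
move=> /run_volume[X [lX Xc]] ul lP sz.
exists [seq x <- X | near r z x]; split.
  by rewrite size_filter; apply: leq_trans (Xc r z) (count_near_particles _ ul lP sz).
by move=> x xz /lX[//|/= xX]; rewrite mem_filter xX near_sym xz.
Qed.

(** Holds whether or not the particles settle, since a walk that never leaves the cluster adds no
    site. *)
Lemma run_size l : exists X : seq (site d), (size X <= size l)%N /\
  forall x, run s set0 l x -> x \in X.
Proof.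
elim/last_ind: l => [|l a [X [Xl lX]]]; first by exists [::].
have [[x xE]|nx] := pselect (exists x, first_outside (run s set0 l) (s a.1 a.2) x).
  exists (x :: X); rewrite size_rcons; split => // y.
  rewrite -cats1 run_cat => -[/lX yX|yE]; first by rewrite inE yX orbT.
  suff -> : y = x by rewrite mem_head.
  case: xE yE => [i [<- xi iA]] [j [<- yj jA]]; congr (s _ _ _).
  by case: (ltngtP i j) => // [/jA|/iA].
exists X; rewrite size_rcons; split; first exact: leqW.
by move=> y; rewrite -cats1 run_cat => -[/lX //|yE]; case: nx; exists y.
Qed.

(* Each round replaces the a priori radius [q^k] by [q^(k-1)]: the cluster met
   by a walk has few sites nearby, and the walk soon leaves such a set. *)
Lemma settles_bootstrap N q k0 l (steps : nat -> nat) : (0 < q)%N -> uniq l ->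
  {subset l <= particles N q} -> ((3 * d).+1 < k0)%N ->
  (size l <= q * (5 * q ^ k0) ^ d.-1)%N ->
  (forall k a, ((3 * d).+1 < k <= k0)%N -> a \in l ->
     forall i, (i <= steps k)%N -> near (q ^ k.-1)%N (s a.1 a.2 i) a.1) ->
  (forall k l1 a l2, ((3 * d).+1 < k <= k0)%N -> l = l1 ++ a :: l2 ->
     (exists X : seq (site d), (size X <= q * (5 * q ^ k) ^ d.-1)%N /\
        forall x, near (q ^ k.-1)%N x a.1 -> run s set0 l1 x -> x \in X) ->
     ~ forall i, (i <= steps k)%N -> near (q ^ k.-1)%N (s a.1 a.2 i) a.1 /\
        run s set0 l1 (s a.1 a.2 i)) ->
  settles s (q ^ (3 * d).+1) set0 l.
Proof.
move=> q0 ul lP k0d l0 far stuck.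
(* One round: by [far] the walk is still within [q^(k-1)] of its source after [steps k] steps, and
   by [stuck] it cannot have spent all of them inside the cluster. *)
have settle k : ((3 * d).+1 < k <= k0)%N ->
    (forall l1 a l2, l = l1 ++ a :: l2 ->
       exists X : seq (site d), (size X <= q * (5 * q ^ k) ^ d.-1)%N /\
        forall x, near (q ^ k.-1)%N x a.1 -> run s set0 l1 x -> x \in X) ->
    settles s (q ^ k.-1) set0 l.
  move=> kk vol; apply/settlesP => l1 a l2 lE.
  have al : a \in l by rewrite lE mem_cat mem_head orbT.
  have /existsNP[i /not_implyP[ik /not_andP ni]] := stuck k l1 a l2 kk lE (vol l1 a l2 lE).
  exists i; split; first by case: ni => // ni; have := far k a kk al i ik.
  by move=> i' i'i; apply: (far k a kk al); exact: leq_trans ik.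
have prefix l1 a l2 : l = l1 ++ a :: l2 ->
    [/\ uniq l1, {subset l1 <= particles N q} & source a.1].
  move=> lE; split.
  - by move: ul; rewrite lE cat_uniq => /andP[].
  - by move=> b bl; apply: lP; rewrite lE mem_cat bl.
  - by apply: (@particles_source N q); apply: lP; rewrite lE mem_cat mem_head orbT.
suff : forall j, (j <= k0 - (3 * d).+2)%N -> settles s (q ^ (k0 - j).-1) set0 l.
  move=> /(_ (k0 - (3 * d).+2)%N (leqnn _)).
  by rewrite subKn.
elim=> [|j IH] jk.
  (* Nothing is known yet about where particles settle: the first round bounds the cluster by the
     number of particles. *)
  rewrite subn0; apply: settle; first by rewrite k0d leqnn.
  move=> l1 a l2 lE; have [X [Xl lX]] := run_size l1; exists X; split.
    apply: leq_trans Xl _; apply: leq_trans l0.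
    by rewrite lE size_cat leq_addr.
  by move=> x _; exact: lX.
have -> : (k0 - j.+1 = (k0 - j).-1)%N by rewrite subnS.
have kk : ((3 * d).+1 < (k0 - j).-1 <= k0)%N by lia.
apply: settle => // l1 a l2 lE; have [ul1 l1P sa] := prefix _ _ _ lE.
have sl1 : settles s (q ^ (k0 - j).-1) set0 l1.
  apply/settlesP => m1 b m2 mE.
  move/settlesP: (IH (ltnW jk)) => /(_ m1 b (m2 ++ a :: l2)); apply.
  by rewrite lE mE -catA.
have [X [Xs lX]] := local_volume (q ^ (k0 - j).-1.-1) sl1 ul1 l1P sa.
exists X; split => //; apply: leq_trans Xs _; rewrite mulnC leq_mul2l.
(* With [c' <= c] and [c >= 1] one has [2 * (c' + c) + 1 <= 5 * c], which is the origin of the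
   factor [5]. *)
have : (q ^ (k0 - j).-1.-1 <= q ^ (k0 - j).-1)%N by rewrite leq_pexp2l // leq_pred.
have : (0 < q ^ (k0 - j).-1)%N by rewrite expn_gt0 q0.
set c := (q ^ (k0 - j).-1)%N; set c' := (q ^ _)%N => c0 cc'.
apply/orP; right; case: (d) => [|[|e]] //=; rewrite leq_exp2r //; lia.
Qed.

End particles.

(** * Particles in order of arrival *)

Section order.
Context {R : realType} {d n : nat} (t : site d -> nat -> R).
Variables (Pl : seq (particle d)).
Hypothesis uPl : uniq Pl.

Let present (a : particle d) := 0 <= t a.1 a.2 <= n%:R.

Hypothesis no_ties : {in [seq a <- Pl | present a] &,
  forall a b, t a.1 a.2 = t b.1 b.2 -> a = b}.

Definition ordered : seq (particle d) := sort (by_time t) [seq a <- Pl | present a].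

Lemma by_time_total : total (@by_time d R t).
Proof. by move=> a b; exact: le_total. Qed.

Lemma by_time_trans : transitive (@by_time d R t).
Proof. by move=> b a c; exact: le_trans. Qed.

Lemma mem_ordered a : (a \in ordered) = (a \in Pl) && present a.
Proof. by rewrite mem_sort mem_filter andbC. Qed.

Lemma ordered_uniq : uniq ordered.
Proof. by rewrite sort_uniq filter_uniq. Qed.

Lemma ordered_sorted : sorted (by_time t) ordered.
Proof. exact: sort_sorted by_time_total _. Qed.

(** Without ties [by_time] is antisymmetric on the particles present, so a sorted list is determined
    by its members. *)
Lemma sort_by_timeE l l' : sorted (by_time t) l -> uniq l -> uniq l' ->
  l' =i l -> {subset l <= ordered} -> sort (by_time t) l' = l.
Proof.
move=> sl ul ul' ll' lo.
apply: (@sorted_eq_in _ (by_time t)).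
- by move=> a b c _ _ _; exact: by_time_trans.
- move=> a b; rewrite !mem_sort !ll' => /lo ao /lo bo /le_anti ab.
  by apply: no_ties; rewrite ?mem_filter ?[_ && (_ \in Pl)]andbC -?mem_ordered.
- exact: sort_sorted by_time_total _.
- exact: sl.
- rewrite perm_sort; exact: uniq_perm.
Qed.

(** Identifies the cluster met by [a] during the run with the one whose independence of the walk was
    used to estimate [stuck]. *)
Lemma sort_earlier l1 a l2 : ordered = l1 ++ a :: l2 ->
  sort (by_time t) (earlier n Pl a t) = l1.
Proof.
move=> oE; have := ordered_sorted; rewrite oE (sorted_pairwise by_time_trans).
rewrite pairwise_cat /= => /and3P[/allrelP l1a pl1 /andP[/allP al2 _]].
have := ordered_uniq; rewrite oE cat_uniq => /and3P[ul1 /hasPn dl ul2].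
apply: sort_by_timeE => //.
- by rewrite (sorted_pairwise by_time_trans).
- exact: filter_uniq.
- move=> b; rewrite mem_filter; apply/idP/idP => [/andP[/and3P[b0 bn ba] bP]|bl1].
    have : b \in ordered by rewrite mem_ordered bP /present b0 bn.
    rewrite oE mem_cat inE => /or3P[//|/eqP bE|/al2]; first by move: ba; rewrite bE ltxx.
    by rewrite /by_time leNgt ba.
  have : b \in ordered by rewrite oE mem_cat bl1.
  have ao : a \in ordered by rewrite oE mem_cat mem_head orbT.
  rewrite mem_ordered => /andP[bP pb]; have /andP[-> ->] := pb; rewrite bP andbT /=.
  rewrite lt_neqAle; apply/andP; split; last exact: l1a (mem_head _ _).
  apply/eqP => tab; have ab : b = a.
    apply: no_ties tab; first by rewrite mem_filter pb.
    by move: ao; rewrite mem_ordered mem_filter andbC.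
  by have := dl a (mem_head _ _); rewrite -ab bl1.
- by move=> b bl1; rewrite oE mem_cat bl1.
Qed.

Lemma arrival_listE (M : nat) :
  (forall a, arrivals n t M a <-> [/\ a \in Pl, present a & cylinder M a.1]) ->
  arrival_list n t M = [seq a <- ordered | `[< cylinder M a.1 >]].
Proof.
move=> arrE; rewrite /arrival_list; apply: sort_by_timeE.
- by apply: (sorted_filter by_time_trans); exact: ordered_sorted.
- by rewrite filter_uniq // ordered_uniq.
- exact: fset_uniq.
- have fa : finite_set (arrivals n t M).
    apply: (@sub_finite_set _ _ [set` Pl]); last exact: finite_seq.
    by move=> a /arrE[].
  move=> a; rewrite mem_filter mem_ordered -[a \in fset_set _]/(a \in fset_set (arrivals n t M)).
  rewrite in_fset_set //; apply/idP/idP.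
    by rewrite inE => /arrE[-> -> /asboolP ->].
  by move=> /and3P[/asboolP aM aP pa]; rewrite inE; apply/arrE.
- by move=> a; rewrite mem_filter => /andP[].
Qed.

End order.

(** * One step of stabilization on a good event *)

(** Slots are closed: a source with a point at a common end is active in both, which is harmless
    since activity is only bounded from above. *)
Definition active_slot {R : realType} {d : nat} (t : site d -> nat -> R)
    (c i : nat) (z : site d) : Prop :=
  exists j, i%:R / c%:R <= t z j <= i.+1%:R / c%:R.

Section good_event.
Context {R : realType} {d n : nat}.
Variables (t : site d -> nat -> R) (s : site d -> nat -> nat -> site d).
Variables (N q k0 b c m : nat) (steps : nat -> nat).

Let Pl := particles N.+1 q : seq (particle d).
Let present (a : particle d) := 0 <= t a.1 a.2 <= n%:R.
Let rho := (q ^ (3 * d).+1)%N.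

Definition slot (a : particle d) : nat := Num.trunc (t a.1 a.2 * b%:R).

Lemma slotP (c' : nat) (x : R) : (0 < c')%N -> 0 <= x <= n%:R -> exists i,
  (i <= n * c')%N /\ i%:R / c'%:R <= x <= i.+1%:R / c'%:R.
Proof.
move=> c0 /andP[x0 xn]; exists (Num.trunc (x * c'%:R)).
have cR : (0 : R) < c'%:R by rewrite ltr0n.
have xc0 : 0 <= x * c'%:R by rewrite mulr_ge0.
have := truncn_itv xc0; set k := Num.trunc _ => /andP[k1 k2].
split.
  rewrite -(ler_nat R) natrM; apply: le_trans k1 _.
  by rewrite ler_pM2r.
by rewrite ler_pdivrMr // k1 /= ler_pdivlMr // ltW.
Qed.

Hypothesis q0 : (0 < q)%N.
Hypotheses (b0 : (0 < b)%N) (c0 : (0 < c)%N).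
Hypothesis increasing : forall z, source z -> forall j, t z j < t z j.+1.
Hypothesis few : forall z, z \in source_box N.+1 -> n%:R < t z q.
Hypothesis no_coincidence : forall i z z', (i <= n * c)%N ->
  z \in source_box N.+1 -> z' \in source_box N.+1 ->
  active_slot t c i z -> active_slot t c i z' -> z = z'.

Lemma increasing_lt z i j : source z -> (i < j)%N -> t z i < t z j.
Proof.
move=> sz; elim: j => [//|j IH]; rewrite ltnS leq_eqVlt => /predU1P[->|/IH h].
  exact: increasing.
exact: lt_trans h (increasing sz j).
Qed.

(** Two simultaneous particles share a slot of length [1/c], hence a source by [no_coincidence], and
    the points of one source increase strictly. *)
Lemma good_no_ties : {in [seq a <- Pl | present a] &,
  forall a a', t a.1 a.2 = t a'.1 a'.2 -> a = a'}.
Proof.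
move=> [z j] [z' j']; rewrite !mem_filter !mem_particles /= /present /=.
move=> /andP[pz /andP[zN _]] /andP[_ /andP[zN' _]] tt'.
have [i [iN iz]] := slotP c0 pz.
have zz' : z = z'.
  by apply: (no_coincidence iN) => //; [exists j | exists j'; rewrite -tt'].
rewrite -zz' in tt' zN' *; have /source_boxP[sz _] := zN.
by case: (ltngtP j j') => [/(increasing_lt sz)|/(increasing_lt sz)|->//];
  rewrite tt' ltxx.
Qed.

Lemma good_arrivals M a : (M <= N.+1)%N ->
  arrivals n t M a <-> [/\ a \in Pl, present a & cylinder M a.1].
Proof.
move=> MN; split => [[sa aM pa]|[aP pa aM]]; last first.
  by split => //; exact: particles_source aP.
have aN : a.1 \in source_box N.+1.
  by apply/source_boxP; split => //; exact: cylinder_le aM.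
split => //; rewrite mem_particles aN ltnNge; apply/negP => qa.
have : t a.1 q <= t a.1 a.2.
  by move: qa; rewrite leq_eqVlt => /predU1P[->//|/(increasing_lt sa)/ltW].
by move/(lt_le_trans (few aN)); case/andP: pa => _ h; rewrite ltNge h.
Qed.

Lemma uniq_particles N' q' : uniq (particles N' q' : seq (particle d)).
Proof.
by apply: allpairs_uniq; rewrite ?source_box_uniq ?iota_uniq // => -[? ?] [? ?].
Qed.

Lemma good_aggregate M : (M <= N.+1)%N -> aggregate n t s M =
  run s set0 [seq a <- ordered t Pl (n := n) | `[< cylinder M a.1 >]].
Proof.
move=> MN; rewrite /aggregate (arrival_listE (uniq_particles _ _) good_no_ties) //.
by move=> a; exact: good_arrivals.
Qed.

Lemma good_aggregate_subset M1 M2 : (M1 <= M2 <= N.+1)%N ->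
  aggregate n t s M1 `<=` aggregate n t s M2.
Proof.
move=> /andP[M12 M2N]; rewrite !good_aggregate ?(leq_trans M12) //.
rewrite (_ : [seq a <- _ | `[< cylinder M1 a.1 >]] =
  [seq a <- [seq a <- ordered t Pl (n := n) | `[< cylinder M2 a.1 >]] | `[< cylinder M1 a.1 >]]).
  exact: run_subset.
rewrite -filter_predI; apply: eq_filter => a /=.
by apply/asboolP/andP => [h|[/asboolP]//]; split; apply/asboolP => //; exact: cylinder_le h.
Qed.

Hypothesis k0d : ((3 * d).+1 < k0)%N.
Hypothesis Nq : ((2 * N.+1).+1 <= 5 * q ^ k0)%N.
Hypothesis near_walks : forall k a, ((3 * d).+1 < k <= k0)%N -> a \in Pl ->
  forall i, (i <= steps k)%N -> near (q ^ k.-1)%N (s a.1 a.2 i) a.1.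
Hypothesis not_stuck : forall k a, ((3 * d).+1 < k <= k0)%N -> a \in Pl ->
  let A := run s set0 (sort (by_time t) (earlier n Pl a t)) in
  (exists X : seq (site d), (size X <= q * (5 * q ^ k) ^ d.-1)%N /\
     forall x, near (q ^ k.-1)%N x a.1 -> A x -> x \in X) ->
  ~ forall i, (i <= steps k)%N -> near (q ^ k.-1)%N (s a.1 a.2 i) a.1 /\
     A (s a.1 a.2 i).
Hypothesis no_long_path : forall i z p, (i <= n * b)%N -> uniq (z :: p) ->
  path (near (2 * rho)%N) z p -> {subset z :: p <= source_box N.+1} ->
  (forall y, y \in z :: p -> active_slot t b i y) -> size p = m -> False.

Lemma good_settles : settles s rho set0 (ordered t Pl (n := n)).
Proof.
have oP a : a \in ordered t Pl (n := n) -> a \in Pl by rewrite mem_ordered => /andP[].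
apply: (@settles_bootstrap _ s N.+1 q k0 _ steps) => //.
- exact: ordered_uniq (uniq_particles _ _).
- rewrite size_sort; apply: leq_trans (size_subseq (filter_subseq _ _)) _.
  rewrite size_particles mulnC leq_mul2l; apply/orP; right.
  by case: (d) => [|[|e]] //=; rewrite leq_exp2r.
- by move=> k a kk /oP; exact: near_walks.
- move=> k l1 a l2 kk oE; have aP : a \in Pl by apply: oP; rewrite oE mem_cat mem_head orbT.
  rewrite -(sort_earlier (uniq_particles _ _) good_no_ties oE).
  exact: not_stuck.
Qed.

(** The smaller aggregate is the same run restricted to the particles of [H_N]. The particles left
    out start outside the cylinder of width [N], hence outside every front, and the last front still
    contains [Z_M]. *)
Lemma good_stabilizes M : (M + (n * b).+1 * (2 * rho * m.+1) <= N)%N ->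
  aggregate n t s N.+1 `&` cylinder M = aggregate n t s N `&` cylinder M.
Proof.
move=> MN; set w := (2 * rho * m.+1)%N in MN.
apply/seteqP; split => x [Ax xM]; split => //; last first.
  by apply: good_aggregate_subset Ax; rewrite leqnSn leqnn.
move: Ax; rewrite !good_aggregate ?leqnSn //; set l := ordered _ _.
have -> : [seq a <- l | `[< cylinder N.+1 a.1 >]] = l.
  apply/all_filterP/allP => a; rewrite mem_ordered mem_particles => /andP[/andP[aN _] _].
  by apply/asboolP; case/source_boxP: aN.
(* The front loses [w] per slot; [MN] keeps it at least [M] up to index [n * b + 1]. *)
pose front i := (N - i * w)%N.
pose active i z := (z \in source_box N.+1) && `[< active_slot t b i z >].
have slotE a : a \in l -> (slot a <= n * b)%N /\ active_slot t b (slot a) a.1.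
  rewrite mem_ordered => /andP[_ /andP[a0 an]].
  have bR : (0 : R) < b%:R by rewrite ltr0n.
  have ab0 : 0 <= t a.1 a.2 * b%:R by rewrite mulr_ge0.
  have := truncn_itv ab0; rewrite -/(slot a) => /andP[k1 k2]; split.
    by rewrite -(ler_nat R) natrM; apply: le_trans k1 _; rewrite ler_pM2r.
  by exists a.2; rewrite ler_pdivrMr // k1 /= ler_pdivlMr // ltW.
have rf : forall i z x, (i <= n * b)%N -> reach rho front active i z ->
    near rho x z -> ~ cylinder (front i.+1) x.
  apply: (@reach_recedes _ rho front active m (n * b)) => [i inb|i z p inb up pp ap pm].
    rewrite /front mulSn -/w; have : (i.+1 * w <= (n * b).+1 * w)%N by rewrite leq_mul2r ltnS inb orbT.
    by rewrite mulSn; lia.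
  apply: (no_long_path inb up pp) pm => y yp; have := allP ap y yp => /andP[] //.
  by move=> _ /asboolP.
have pl : path leq 0 (map slot l).
  have sl := ordered_sorted t Pl (n := n).
  rewrite path_min_sorted; last by apply/allP.
  apply: (homo_sorted_in (P := mem l) (e := by_time t)) sl; last exact/allP.
  move=> a a' al a'l aa'; rewrite /slot.
  by apply: le_truncn; rewrite ler_wpM2r.
move=> Ax; apply: contrapT => A'x.
have fr i : (front i.+1 <= front i)%N by rewrite /front mulSn; lia.
have [] := @run_discrepancy _ s rho front active (n * b) fr rf slot
  (fun a => `[< cylinder N a.1 >]) 0 l set0 set0 good_settles (@subset_refl _ _) pl (leq0n _).
- move=> a al; have [sa aa] := slotE a al; split => //.
    apply/andP; split; last exact/asboolP.
    by move: al; rewrite mem_ordered mem_particles => /andP[/andP[]].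
  by move=> /asboolP ncyl cf; apply: ncyl; apply: cylinder_le cf; exact: leq_subr.
- by move=> y [].
move=> i inb /(_ x Ax A'x) h.
have : ~ cylinder (front i.+1) x.
  case: h => [h cf|[z [iz xz]]]; last exact: rf iz xz.
  by apply: h; apply: cylinder_le cf.
apply; apply: cylinder_le xM.
have : (i.+1 * w <= (n * b).+1 * w)%N by rewrite leq_mul2r ltnS inb orbT.
rewrite /front; lia.
Qed.

End good_event.

(** * Probability of the bad events *)

Section chains.
Context {d : nat}.

Fixpoint chains (r m : nat) (z : site d) : seq (seq (site d)) :=
  if m is m'.+1 then
    [seq (z + v) :: p | v <- source_box r, p <- chains r m' (z + v)]
  else [:: [::]].

Lemma size_chains r m z : size (chains r m z) = (((2 * r).+1 ^ d.-1) ^ m)%N.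
Proof.
elim: m z => [//|m IH] z; rewrite /= size_allpairs_dep.
rewrite (eq_map (g := fun=> (((2 * r).+1 ^ d.-1) ^ m)%N)); last by move=> v; exact: IH.
rewrite sumnE big_map big_const_seq count_predT iter_addn_0 size_source_box.
by rewrite expnS mulnC.
Qed.

Lemma mem_chains r z (p : seq (site d)) : source z -> path (near r) z p -> {in p, forall y, source y} ->
  p \in chains r (size p) z.
Proof.
elim: p z => [|y p IH] z sz /=; first by rewrite mem_head.
move=> /andP[zy yp] sp; have sy : source y by apply: sp; rewrite mem_head.
have zyE : z + (y - z) = y by rewrite addrC subrK.
apply/allpairsPdep; exists (y - z), p; split; rewrite ?zyE //.
  by apply: near_source_box => //; rewrite near_sym.
by apply: IH => // x xp; apply: sp; rewrite inE xp orbT.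
Qed.

End chains.

Section bad_events.
Context {R : realType} {disp : measure_display} {T : measurableType disp}.
Variable P : probability T R.
Context {d : nat} (n : nat) (tau : site d -> nat -> T -> R)
  (S : site d -> nat -> nat -> T -> site d).
Hypothesis inputs : idla_inputs P tau S.

Let t w z j := tau z j w.

Lemma measurable_active c i z : source z ->
  measurable [set w | active_slot (t w) c i z].
Proof.
move=> sz; apply: measurable_ex => j.
have -> : [set w | i%:R / c%:R <= t w z j <= i.+1%:R / c%:R] =
    [set w | tau z j w \in `[i%:R / c%:R, i.+1%:R / c%:R]].
  by apply/seteqP; split => w /=; rewrite in_itv.
by apply: (measurable_tau_itv inputs).
Qed.

Lemma active_slots_le c i (p : seq (site d)) : (0 < c)%N -> uniq p -> {in p, forall z, source z} ->
  (P [set w | forall z, z \in p -> active_slot (t w) c i z] <=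
   ((c%:R ^- size p))%:E)%E.
Proof.
move=> c0 up sp.
have ic : i%:R / c%:R <= i.+1%:R / c%:R :> R by rewrite ler_wpM2r ?invr_ge0 ?ler_nat.
apply: le_trans (active_all_le inputs up sp _ ic) _; first by rewrite divr_ge0.
by rewrite -mulrBl -natr1 addrAC subrr add0r mul1r exprVn.
Qed.

Lemma measurable_all_active c i (p : seq (site d)) : {in p, forall z, source z} ->
  measurable [set w | forall z, z \in p -> active_slot (t w) c i z].
Proof.
move=> sp; have -> : [set w | forall z, z \in p -> active_slot (t w) c i z] =
    [set w | forall z, source z -> z \in p -> active_slot (t w) c i z].
  by apply/seteqP; split => w /= h z => [_|zp]; apply: h => //; exact: sp.
apply: measurable_all => z; have [sz|nsz] := pselect (source z).
  apply: measurable_impl; first exact: measurable_constant.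
  apply: measurable_impl; first exact: measurable_constant.
  exact: measurable_active.
rewrite (_ : [set w | _] = setT) //; apply/seteqP; split => // w _ sz.
by case: (nsz sz).
Qed.

Variables (N : nat).

Definition crowded q w : Prop := exists2 z, z \in source_box N.+1 & t w z q <= n%:R.

Definition slot_pairs c : seq (nat * (site d * site d)) :=
  [seq izz <- [seq (i, zz) | i <- iota 0 (n * c).+1,
     zz <- [seq (z, z') | z <- source_box N.+1, z' <- source_box N.+1]] | izz.2.1 != izz.2.2].

Definition slot_chains b r m : seq (nat * seq (site d)) :=
  [seq ip <- [seq (i, p) | i <- iota 0 (n * b).+1,
    p <- [seq z :: p | z <- source_box N.+1, p <- chains r m z]] |
    uniq ip.2 && all (fun z => z \in source_box N.+1) ip.2 ].

Definition coincident c w : Prop := exists2 izz : nat * (site d * site d),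
  izz \in slot_pairs c &
  forall z, z \in [:: izz.2.1; izz.2.2] -> active_slot (t w) c izz.1 z.

Definition chained b r m w : Prop := exists2 ip : nat * seq (site d),
  ip \in slot_chains b r m &
  forall z, z \in ip.2 -> active_slot (t w) b ip.1 z.

Local Notation box := ((2 * N.+1).+1 ^ d.-1)%N.

Lemma source_boxW r (z : site d) : z \in source_box r -> source z.
Proof. by case/source_boxP. Qed.

Lemma crowded_measurable q : measurable [set w | crowded q w].
Proof.
have -> : [set w | crowded q w] = [set w | exists z, z \in source_box N.+1 /\ t w z q <= n%:R].
  by apply/seteqP; split => w /= [z]; [move=> zN h | move=> [zN h]]; exists z.
apply: measurable_ex => z; have [zN|zN] := boolP (z \in source_box N.+1).
  apply: measurable_and; first exact: measurable_constant.
  have -> : [set w | t w z q <= n%:R] = [set w | tau z q w \in `]-oo, n%:R]].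
    by apply/seteqP; split => w /=; rewrite in_itv.
  by apply: (measurable_tau_itv inputs); exact: source_boxW zN.
by rewrite (_ : [set w | _] = set0) //; apply/seteqP; split => w // [].
Qed.

Lemma crowded_le q : (P [set w | crowded q w] <= (box%:R * (expR n%:R / 2 ^+ q))%:E)%E.
Proof.
rewrite -size_source_box.
apply: (union_bound_const (A := fun z => [set w | t w z q <= n%:R])) => //.
- exact: crowded_measurable.
- move=> z /source_boxW sz.
  have -> : [set w | t w z q <= n%:R] = [set w | tau z q w \in `]-oo, n%:R]].
    by apply/seteqP; split => w /=; rewrite in_itv.
  by apply: (measurable_tau_itv inputs).
- move=> z /source_boxW sz; apply: poisson_many_le.
  by case: inputs => pp _ _; exact: pp.
Qed.

Lemma measurable_ex2 (I : countType) (s : seq I) (A : I -> T -> Prop) :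
  (forall i, i \in s -> measurable [set w | A i w]) ->
  measurable [set w | exists2 i, i \in s & A i w].
Proof.
move=> mA; have -> : [set w | exists2 i, i \in s & A i w] = [set w | exists i, i \in s /\ A i w].
  by apply/seteqP; split => w /= [i]; [move=> ii h | move=> [ii h]]; exists i.
apply: measurable_ex => i; have [ii|ii] := boolP (i \in s).
  by apply: measurable_and; [exact: measurable_constant | exact: mA].
by rewrite (_ : [set w | _] = set0) //; apply/seteqP; split => w // [].
Qed.

Lemma coincident_measurable c : measurable [set w | coincident c w].
Proof.
apply: measurable_ex2 => -[i [z z']].
rewrite mem_filter => /andP[_ /allpairsP[[i' zz'] /= [_ /allpairsP[[y y'] /= [yN yN' ->]] [-> -> ->]]]].
apply: measurable_all_active => x; rewrite !inE => /orP[] /eqP ->;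
  [exact: source_boxW yN | exact: source_boxW yN'].
Qed.

Lemma coincident_le c : (0 < c)%N ->
  (P [set w | coincident c w] <= (((n * c).+1 * box ^ 2)%N%:R * c%:R ^- 2)%:E)%E.
Proof.
move=> c0; set s := slot_pairs c.
have ss izz : izz \in s -> uniq [:: izz.2.1; izz.2.2] /\ {in [:: izz.2.1; izz.2.2], forall z : site d, source z}.
  rewrite mem_filter => /andP[+]; case: izz => i [z z'] zz.
  move=> /allpairsP[[i' zz'] /= [_ /allpairsP[[y y'] /= [yN yN' ->]] [_ zE zE']]].
  split; first by rewrite /= inE andbT; exact: zz.
  by move=> x; rewrite !inE zE zE' => /orP[] /eqP ->;
    [exact: source_boxW yN | exact: source_boxW yN'].
apply: le_trans (union_bound_const (P := P) (s := s) (c := c%:R ^- 2)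
  (A := fun izz => [set w | forall z, z \in [:: izz.2.1; izz.2.2] -> active_slot (t w) c izz.1 z]) _ _ _ _) _.
- exact: coincident_measurable.
- by move=> izz /ss[_]; exact: measurable_all_active.
- by move=> izz /ss[us sss]; exact: (active_slots_le izz.1 c0 us sss).
- by [].
rewrite lee_fin ler_wpM2r ?invr_ge0 ?exprn_ge0 // ler_nat.
rewrite size_filter; apply: leq_trans (count_size _ _) _.
by rewrite !size_allpairs size_iota size_source_box mulnn.
Qed.

Lemma chained_measurable b r m : measurable [set w | chained b r m w].
Proof.
apply: measurable_ex2 => ip; rewrite mem_filter => /andP[/andP[_ /allP ps] _].
by apply: measurable_all_active => z /ps /source_boxW.
Qed.

(** There are [n b + 1] slots, [box] starting points and at most [(2r+1)^(d-1)] choices per link;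
    the [m+1] distinct sources are active independently, each with probability at most [1/b]. *)
Lemma chained_le b r m : (0 < b)%N ->
  (P [set w | chained b r m w] <=
   (((n * b).+1 * (box * ((2 * r).+1 ^ d.-1) ^ m))%N%:R * b%:R ^- m.+1)%:E)%E.
Proof.
move=> b0; set s := slot_chains b r m.
have chain_size (z : site d) p : p \in chains r m z -> size p = m.
  elim: (m) z p => [|m' IH] z p; first by rewrite inE => /eqP ->.
  by move=> /allpairsPdep[v [p' [_ /IH <- ->]]].
have ss ip : ip \in s -> [/\ uniq ip.2, {in ip.2, forall z : site d, source z} & size ip.2 = m.+1].
  rewrite mem_filter => /andP[/andP[up /allP ps] h]; split => //.
    by move=> z /ps /source_boxW.
  move: h => /allpairsP[[i p] /= [_ /allpairsPdep[z [p' [_ pc ->]]] ->]] /=.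
  by rewrite (chain_size _ _ pc).
apply: le_trans (union_bound_const (P := P) (s := s) (c := b%:R ^- m.+1)
  (A := fun ip => [set w | forall z, z \in ip.2 -> active_slot (t w) b ip.1 z]) _ _ _ _) _.
- exact: chained_measurable.
- by move=> ip /ss[_ + _]; exact: measurable_all_active.
- by move=> ip /ss[up ps <-]; exact: (active_slots_le ip.1 b0 up ps).
- by [].
rewrite lee_fin ler_wpM2r ?invr_ge0 ?exprn_ge0 // ler_nat.
rewrite size_filter; apply: leq_trans (count_size _ _) _.
rewrite size_allpairs size_iota leq_mul2l; apply/orP; right.
rewrite size_allpairs_dep.
rewrite (eq_map (g := fun=> (((2 * r).+1 ^ d.-1) ^ m)%N)); last by move=> v; exact: size_chains.
by rewrite sumnE big_map big_const_seq count_predT iter_addn_0 size_source_box mulnC.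
Qed.

End bad_events.

(** With [2^j <= q < 2^(j+1)], the claim follows from [(j+1) * E <= 2^j], which holds once
    [j >= 2 * E]. *)
Lemma expn_le_exp2 E : exists q0, forall q, (q0 <= q)%N -> (q ^ E <= 2 ^ q)%N.
Proof.
have base : ((2 * E).+1 * E <= 2 ^ (2 * E))%N.
  elim: E => [//|E IH]; rewrite (mulnS 2 E) expnD -[(2 ^ 2)%N]/4%N.
  have [->//|E0] := posnP E; nia.
have linear j : (2 * E <= j)%N -> (j.+1 * E <= 2 ^ j)%N.
  elim: j => [|j IH] Ej; first by have -> : E = 0%N by lia.
  have [jE|jE] := leqP (2 * E) j; first by have := IH jE; rewrite expnS; nia.
  by have <- : (2 * E = j.+1)%N by lia.
exists (2 ^ (2 * E))%N => q q1.
have q0 : (0 < q)%N by apply: leq_trans q1; rewrite expn_gt0.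
have := trunc_log_bounds (isT : (1 < 2)%N) q0; set j := trunc_log 2 q => /andP[jq qj].
have Ej : (2 * E <= j)%N by rewrite -ltnS -(ltn_exp2l _ _ (isT : (1 < 2)%N)) (leq_ltn_trans q1).
apply: (@leq_trans ((2 ^ j.+1) ^ E)%N).
  by case: (E) => [|e] //; rewrite leq_exp2r // ltnW.
by rewrite -expnM leq_exp2l //; apply: leq_trans (linear j Ej) jq.
Qed.

Lemma root_bounds K N : (0 < K)%N -> exists q, (q ^ K <= N < q.+1 ^ K)%N.
Proof.
move=> K0; have ex : exists q, (q ^ K <= N)%N by exists 0%N; rewrite exp0n.
have bd q : (q ^ K <= N)%N -> (q <= N)%N.
  by apply: leq_trans; case: q => // q; rewrite -[X in (X <= _)%N]expn1 leq_pexp2l.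
case: (ex_maxnP ex bd) => q qN qmax; exists q; rewrite qN ltnNge /=.
by apply/negP => /qmax; rewrite ltnn.
Qed.

Lemma ratio_le (R : realFieldType) (a c x y : nat) : (0 < x)%N -> (0 < y)%N ->
  (a * y <= c * x)%N -> a%:R / x%:R <= c%:R / y%:R :> R.
Proof.
move=> x0 y0 h; rewrite ler_pdivrMr ?ltr0n // mulrAC ler_pdivlMr ?ltr0n //.
by rewrite -!natrM ler_nat.
Qed.

(** * Walks that stay in the cluster or move too far *)

Section walks.
Context {R : realType} {disp : measure_display} {T : measurableType disp}.
Variable P : probability T R.
Context {d : nat} (n : nat) (tau : site d -> nat -> T -> R)
  (S : site d -> nat -> nat -> T -> site d).
Hypothesis inputs : idla_inputs P tau S.
Hypothesis hd : (0 < d)%N.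
Variables (N q k0 : nat).

Definition scales : seq (nat * particle d) :=
  [seq (k, a) | k <- iota (3 * d).+2 k0, a <- particles N.+1 q].

Lemma size_scales : size scales = (k0 * ((2 * N.+1).+1 ^ d.-1 * q))%N.
Proof. by rewrite size_allpairs size_iota size_particles. Qed.

Lemma scalesP ka : ka \in scales ->
  ((3 * d).+1 < ka.1 < (3 * d).+2 + k0)%N /\ source ka.2.1.
Proof.
move=> /allpairsP[[k a] /= [kk aP ->]] /=; split; last exact: particles_source aP.
by move: kk; rewrite mem_iota.
Qed.

(** These are [q] blocks of [u^2] steps with [u = q^(k-3)]: confinement through all blocks has
    probability at most [2^-q]. Moreover [steps k <= (q^(k-2))^2], so being farther than
    [q^(k-2) * q = q^(k-1)] at a given time has probability of order [2^-q] as well. *)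
Definition steps k := (q * (q ^ (k - 3)) ^ 2)%N.

Definition jammed w : Prop := exists2 ka, ka \in scales &
  stuck n tau S (particles N.+1 q) ka.2 (q * (5 * q ^ ka.1) ^ d.-1) (q ^ ka.1.-1)
    (steps ka.1) w.

Definition strayed w : Prop := exists2 ka, ka \in scales &
  exists i, (i <= steps ka.1)%N /\ ~~ near (q ^ ka.1.-1)%N (S ka.2.1 ka.2.2 i w) ka.2.1.

Let sPl : {in particles N.+1 q, forall b : particle d, source b.1}.
Proof. by move=> b; exact: particles_source. Qed.

Lemma jammed_measurable : measurable [set w | jammed w].
Proof.
apply: measurable_ex2 => ka /scalesP[_ sa].
exact: (stuck_measurable n inputs sPl sa).
Qed.

Lemma strayed_measurable : measurable [set w | strayed w].
Proof.
apply: measurable_ex2 => ka /scalesP[_ sa]; apply: measurable_ex => i.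
apply: measurable_and; first exact: measurable_constant.
have [_ srw _] := inputs.
exact: (measurable_walk (srw ka.2.1 ka.2.2 sa)
  (fun x => ~~ near (q ^ ka.1.-1)%N x ka.2.1) i).
Qed.

Lemma jammed_le : (0 < q)%N -> (2 * 5 ^ d.-1 * (d ^ d).+1 <= q)%N ->
  (P [set w | jammed w] <= ((size scales)%:R * (2 ^ q)%:R^-1)%:E)%E.
Proof.
move=> q0 dq.
apply: (union_bound_const (A := fun ka => [set w |
  stuck n tau S (particles N.+1 q) ka.2 (q * (5 * q ^ ka.1) ^ d.-1) (q ^ ka.1.-1)
    (steps ka.1) w])) => //.
- exact: jammed_measurable.
- by move=> ka /scalesP[_ sa]; exact: (stuck_measurable n inputs sPl sa).
- move=> [k a] /scalesP[/= /andP[kd _] sa].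
  apply: (stuck_le n inputs sPl sa hd); first by rewrite expn_gt0 q0.
  rewrite expnMn -expnM.
  apply: (@leq_trans (q * (q * q ^ (k * d.-1)))%N).
    apply: leq_trans (leq_mul dq (leqnn _)).
    set y := (5 ^ _)%N; set x := (q ^ _)%N; set z := (d ^ d).+1; nia.
  (* The exponents compare as [k * (d-1) + 2 <= (k-3) * d], that is [k >= 3d+2]: this is what stops
     the descent at [q^(3d+1)]. *)
  rewrite -!expnS -expnM leq_pexp2l //.
  case: (d) hd kd => // e _ kd /=; nia.
Qed.

Lemma strayed_le : (0 < q)%N -> (P [set w | strayed w] <=
  ((size scales)%:R * ((q ^ (2 * ((3 * d).+2 + k0)).+1).+1%:R * ((4 * d)%:R / (2 ^ q)%:R)))%:E)%E.
Proof.
move=> q0; have [_ srw _] := inputs.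
apply: (union_bound_const (A := fun ka => [set w |
  exists i, (i <= steps ka.1)%N /\ ~~ near (q ^ ka.1.-1)%N (S ka.2.1 ka.2.2 i w) ka.2.1])) => //.
- exact: strayed_measurable.
- move=> ka /scalesP[_ sa]; apply: measurable_ex => i.
  apply: measurable_and; first exact: measurable_constant.
  exact: (measurable_walk (srw ka.2.1 ka.2.2 sa)
    (fun x => ~~ near (q ^ ka.1.-1)%N x ka.2.1) i).
- move=> [k a] /scalesP[/= /andP[kd kk] sa].
  have vq : (q * q ^ (k - 3) * q = q ^ k.-1)%N.
    by rewrite -expnS -expnSr; congr (q ^ _)%N; lia.
  rewrite -vq; apply: le_trans (far_walk_upto_le hd (srw a.1 a.2 sa) (v := (q * q ^ (k - 3))%N) q _ _) _.
  + by rewrite muln_gt0 q0 expn_gt0 q0.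
  + by rewrite /steps expnMn leq_mul2r; apply/orP; right; rewrite -[leqLHS]expn1 leq_pexp2l.
  rewrite lee_fin ler_wpM2r ?divr_ge0 // ler_nat ltnS /steps -expnM -expnS.
  by rewrite leq_pexp2l //; lia.
Qed.

End walks.

Lemma slot_count_le n b A B : (0 < b)%N -> (A <= B)%N ->
  ((n * b).+1 * A <= n.+1 * (b * B))%N.
Proof.
move=> b0 AB; rewrite mulnA; apply: leq_mul => //.
by rewrite mulSn addnC -addn1 leq_add2l.
Qed.

Lemma coincidence_count_le n c X y : (0 < c)%N -> (X * y <= c)%N -> ((n * c).+1 * X * y <= n.+1 * c ^ 2)%N.
Proof. by move=> c0 h; rewrite -mulnA -mulnn slot_count_le. Qed.

Lemma chain_count_le n b X Z y W G : (0 < b)%N -> (Z <= W)%N -> (X * y <= G)%N ->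
  ((n * b).+1 * (X * Z) * y <= n.+1 * (b * (W * G)))%N.
Proof.
move=> b0 ZW XG; rewrite -mulnA slot_count_le // mulnAC mulnC; exact: leq_mul.
Qed.

Lemma particle_count_le s q X y Y i G H : (s <= q * (X * q))%N -> (X <= G)%N -> (y <= Y)%N ->
  (q ^ i * G * Y * (q * q) = H)%N -> (s * q ^ i * y <= H)%N.
Proof.
move=> sq XG yY <-.
apply: (@leq_trans ((q * (G * q)) * q ^ i * Y)%N).
  by rewrite !leq_mul // (leq_trans sq) // leq_mul2l leq_mul2r XG !orbT.
move: (q ^ i)%N => z; lia.
Qed.

Lemma box_width_le rho q : (0 < rho)%N -> (5 <= q)%N -> ((2 * (2 * rho)).+1 <= q * rho)%N.
Proof. move=> r0 q5; apply: leq_trans (leq_mul q5 (leqnn _)); lia. Qed.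

Lemma succ_le_mul q x : (0 < x)%N -> (5 <= q)%N -> (x.+1 <= q * x)%N.
Proof. move=> r0 q5; apply: leq_trans (leq_mul q5 (leqnn _)); lia. Qed.

Lemma front_room M N n b rho m : (0 < b)%N -> (2 * M <= N)%N -> (4 * n.+1 * m.+1 * (b * rho) <= N)%N ->
  (M + (n * b).+1 * (2 * rho * m.+1) <= N)%N.
Proof.
move=> b0 MN h.
have := slot_count_le n b0 (leqnn (2 * rho * m.+1)%N); move: (_ * (2 * rho * m.+1))%N => x.
have : (n.+1 * (b * (2 * rho * m.+1)) * 2 = 4 * n.+1 * m.+1 * (b * rho))%N by lia.
lia.
Qed.

(** [C] and [N0] come before the probability space, the constant of the theorem being uniform in it.
    Strict increase of the points is a hypothesis on [w], to be met later outside one null set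
    common to all [N]. *)
Lemma one_step (R : realType) (d n p : nat) : (0 < d)%N ->
  exists (C : R) (N0 : nat), 0 <= C /\
  forall (disp : measure_display) (T : measurableType disp) (P : probability T R)
    (tau : site d -> nat -> T -> R) (S : site d -> nat -> nat -> T -> site d),
  idla_inputs P tau S -> forall N, (N0 <= N)%N ->
  exists Bad : set T, [/\ measurable Bad, (P Bad <= (C / N%:R ^+ p)%:E)%E &
    forall w, ~ Bad w -> (forall z, source z -> forall j, tau z j w < tau z j.+1 w) ->
    let t := fun z j => tau z j w in
    let s := fun z j k => S z j k w in
    (forall M, (2 * M <= N)%N ->
      aggregate n t s N.+1 `&` cylinder M = aggregate n t s N `&` cylinder M) /\
    (forall M1 M2, (M1 <= M2 <= N.+1)%N -> aggregate n t s M1 `<=` aggregate n t s M2)].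
Proof.
move=> hd.
(* Time slots have length [q^-beta] for chains, of [m.+1] sources, and [q^-gam]
   for coincidences; [N^p <= q^Q] and [H_(N+1)] has at most [q^g] sites. *)
pose h := ((3 * d).+2 * d.-1)%N; pose beta := h.+1.
(* [N >= q^K = q * (q^beta * rho)], and the spare factor [q] absorbs the constants in the total
   recession of the front. Conversely [N < q^(K+1)] for large [q], so [e = K+2] ensures
   [2N+3 <= q^e]. *)
pose K := (beta + (3 * d).+2)%N; pose e := K.+2; pose Q := (K.+1 * p)%N.
(* For coincidences there are at most [q^(2g)] pairs and about [n c] slots, against [c^-2], which
   leaves [q^(2g) / c = q^-Q]. For chains, a link has at most [q^h] choices and gains [q^-beta],
   which leaves [1/q]; [m] links pay for the [q^g] starting points and for [N^p]. *)
pose g := (e * d.-1)%N; pose gam := (2 * g + Q)%N; pose m := (g + Q)%N.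
pose E := (g + 2 * ((3 * d).+2 + e) + 5 + Q)%N.
have [q1 hq1] := expn_le_exp2 E.
pose qmin := (q1 + 2 ^ K + 5 + 2 * 5 ^ d.-1 * (d ^ d).+1 + 4 * n.+1 * m.+1 + 4 * d + e)%N.
(* One term for each of [crowded], [coincident], [chained], [jammed] and [strayed]. *)
exists (expR n%:R + n.+1%:R + n.+1%:R + 1 + 1), (qmin ^ K)%N; split.
  by rewrite !addr_ge0 // expR_ge0.
move=> disp T P tau S inputs N NN.
have K0 : (0 < K)%N by [].
have [q /andP[qN Nq]] := root_bounds N K0.
have qq : (qmin <= q)%N by rewrite -ltnS -(ltn_exp2r _ _ K0) (leq_ltn_trans NN).
have qbounds : [/\ (2 ^ K <= q)%N, (5 <= q)%N, (2 * 5 ^ d.-1 * (d ^ d).+1 <= q)%N,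
    (4 * n.+1 * m.+1 <= q)%N & [/\ (4 * d <= q)%N, (e <= q)%N & (q1 <= q)%N]].
  move: qq; rewrite /qmin; move: (2 ^ K)%N (2 * 5 ^ d.-1 * (d ^ d).+1)%N (4 * n.+1 * m.+1)%N.
  by move=> x1 x2 x3; split; first [split; lia | lia].
have [qK q5 qd qm [q4d qe qq1]] := qbounds.
have q0 : (0 < q)%N by lia.
have qpos i : (0 < q ^ i)%N by rewrite expn_gt0 q0.
have N1 : (N < q ^ K.+1)%N.
  apply: leq_trans Nq _; apply: (@leq_trans ((2 * q) ^ K)%N).
    by rewrite leq_exp2r //; lia.
  by rewrite expnMn expnS leq_mul2r qK orbT.
have NE : ((2 * N.+1).+1 <= q ^ e)%N.
  rewrite /e expnS; apply: leq_trans (leq_mul q5 (leqnn _)).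
  by move: N1; move: (q ^ K.+1)%N => x; lia.
have N0 : (0 < N)%N by apply: leq_trans qN.
pose y := (N ^ p)%N; have y0 : (0 < y)%N by rewrite expn_gt0 N0.
have yQ : (y <= q ^ Q)%N.
  rewrite /y /Q expnM; case: (p) => // p'; rewrite leq_exp2r //; exact: ltnW.
pose X := ((2 * N.+1).+1 ^ d.-1)%N.
have Xg : (X <= q ^ g)%N.
  by rewrite /X /g expnM; case: (d.-1) => // d'; rewrite leq_exp2r.
have Xy : (X * y <= q ^ m)%N by rewrite /m expnD; exact: leq_mul.
pose rho := (q ^ (3 * d).+1)%N.
pose b := (q ^ beta)%N; pose c := (q ^ gam)%N; pose r := (2 * rho)%N.
have b0 : (0 < b)%N := qpos _. have c0 : (0 < c)%N := qpos _.
pose Bad := [set w | crowded n tau N q w \/ (coincident n tau N c w \/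
  (chained n tau N b r m w \/ (jammed n tau S N q e w \/ strayed S N q e w)))].
have m1 := crowded_measurable n inputs N q.
have m2 := coincident_measurable n inputs N c.
have m3 := chained_measurable n inputs N b r m.
have m4 := jammed_measurable n inputs N q e.
have m5 := strayed_measurable inputs N q e.
have or_le (A B : set T) x x' : measurable A -> measurable B -> (P A <= x%:E)%E ->
    (P B <= x'%:E)%E -> (P [set w | A w \/ B w] <= (x + x')%:E)%E.
  move=> mA mB Ax Bx; rewrite EFinD; apply: le_trans (leeD Ax Bx).
  exact: measureU2.
have sz : (size (scales N q e : seq (nat * particle d)) <= q * (X * q))%N.
  by rewrite size_scales leq_mul2r qe orbT.
have szE i : (i + g + Q + 2 <= E)%N ->
    (size (scales N q e : seq (nat * particle d)) * q ^ i * y <= 2 ^ q)%N.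
  move=> iE; apply: leq_trans (hq1 q qq1).
  apply: (@leq_trans (q ^ (i + g + Q + 2))%N); last by rewrite leq_pexp2l.
  by apply: particle_count_le sz Xg yQ _; rewrite !expnD.
exists Bad; split.
- by do 4!(apply: measurable_or => //).
- have -> : (expR n%:R + n.+1%:R + n.+1%:R + 1 + 1) / N%:R ^+ p =
     expR n%:R / y%:R + (n.+1%:R / y%:R + (n.+1%:R / y%:R + (1%:R / y%:R + 1%:R / y%:R))) :> R.
    by rewrite -natrX -/y !mulrDl !addrA.
  apply: (or_le) => //; [by do 3!(apply: measurable_or => //) | | ].
    apply: le_trans (crowded_le n inputs N q) _; rewrite lee_fin -/X mulrCA ler_wpM2l ?expR_ge0 //.
    rewrite -natrX -[leRHS]mul1r; apply: (@ratio_le R X 1) => //; first by rewrite expn_gt0.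
    rewrite mul1n; apply: leq_trans Xy (leq_trans _ (hq1 q qq1)).
    by rewrite leq_pexp2l // /m /E; lia.
  apply: (or_le) => //; [by do 2!(apply: measurable_or => //) | | ].
    apply: le_trans (coincident_le n inputs N c0) _; rewrite lee_fin -/X -natrX.
    apply: ratio_le => //; first by rewrite expn_gt0 c0.
    apply: coincidence_count_le => //.
    rewrite /c /gam expnD mulnC expnM -mulnn mulnC; apply: leq_mul => //.
    by rewrite expnAC leq_sqr.
  apply: (or_le) => //; [by do 1!(apply: measurable_or => //) | | ].
    apply: le_trans (chained_le n inputs N r m b0) _; rewrite lee_fin -/X -natrX.
    apply: ratio_le => //; first by rewrite expn_gt0 b0.
    have Zh : ((2 * r).+1 ^ d.-1 <= q ^ h)%N.
      rewrite /h expnM; case: (d.-1) => // d'; rewrite leq_exp2r // expnS.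
      exact: box_width_le (qpos _) q5.
    have Zm : (((2 * r).+1 ^ d.-1) ^ m <= (q ^ h) ^ m)%N by case: (m) => // m'; rewrite leq_exp2r.
    have bm : (b ^ m.+1 = b * ((q ^ h) ^ m * q ^ m))%N.
      by rewrite expnS /b /beta expnSr expnMn.
    by rewrite bm; exact: chain_count_le.
  apply: (or_le) => //.
    apply: le_trans (jammed_le n inputs hd N e q0 qd) _; rewrite lee_fin.
    apply: ratio_le => //; first by rewrite expn_gt0.
    have := szE 0%N; rewrite expn0 muln1 mul1n; apply; rewrite /E; lia.
  apply: le_trans (strayed_le inputs hd N e q0) _; rewrite lee_fin.
  rewrite !mulrA -!natrM; apply: ratio_le => //; first by rewrite expn_gt0.
  rewrite mul1n; apply: leq_trans (szE (2 * ((3 * d).+2 + e)).+3 _); last by rewrite /E; lia.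
  rewrite leq_mul2r; apply/orP; right; rewrite -mulnA leq_mul2l; apply/orP; right.
  rewrite mulnC [X in (_ <= X)%N]expnS; apply: leq_mul; first exact: q4d.
  by rewrite [X in (_ <= X)%N]expnS; exact: succ_le_mul (qpos _) q5.
move=> w nBad incr t s.
have [nc nd nl nj ns] : [/\ ~ crowded n tau N q w, ~ coincident n tau N c w,
    ~ chained n tau N b r m w, ~ jammed n tau S N q e w & ~ strayed S N q e w].
  by split=> h1; apply: nBad; rewrite /Bad /=; tauto.
have few z : z \in source_box N.+1 -> n%:R < t z q.
  by move=> zN; rewrite ltNge; apply/negP => tz; apply: nc; exists z.
have no_coincidence i z z' : (i <= n * c)%N -> z \in source_box N.+1 ->
    z' \in source_box N.+1 -> active_slot t c i z -> active_slot t c i z' -> z = z'.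
  move=> ic zN zN' az az'; apply: contrapT => /eqP zz'; apply: nd.
  exists (i, (z, z')); last by move=> x; rewrite !inE => /orP[] /eqP ->.
  rewrite mem_filter; apply/andP; split; first exact: zz'.
  apply/allpairsP; exists (i, (z, z')); split => //.
    by rewrite mem_iota ltnS.
  by apply/allpairsP; exists (z, z').
have inscale k (a : particle d) : ((3 * d).+1 < k <= e)%N -> a \in particles N.+1 q ->
    (k, a) \in scales N q e.
  move=> kk aP; apply/allpairsP; exists (k, a); split => //.
  have inrange x : ((3 * d).+1 < k <= x -> (3 * d).+1 < k < (3 * d).+2 + x)%N by lia.
  by rewrite mem_iota; exact: inrange.
split; last first.
  by move=> M1 M2 MM; apply: (@good_aggregate_subset R d n t s N q c).
move=> M MN; apply: (@good_stabilizes R d n t s N q e b c m (steps q)) => //.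
- by rewrite /e /K; lia.
- by apply: leq_trans NE _; rewrite leq_pmull.
- move=> k a kk aP i ik; apply: contrapT => /negP ni; apply: ns.
  by exists (k, a); [exact: inscale | exists i].
- move=> k a kk aP A volA sA; apply: nj; exists (k, a); first exact: inscale.
  by split.
- move=> i z v ib uv pv sv act vm; apply: nl; exists (i, z :: v) => //.
  rewrite mem_filter; apply/andP; split; first by apply/andP; split => //; exact/allP.
  apply/allpairsP; exists (i, z :: v); split => //; first by rewrite mem_iota ltnS.
  apply/allpairsPdep; exists z, v; split => //; first by apply: sv; rewrite mem_head.
  rewrite -vm; apply: mem_chains => //.
    by apply: (@source_boxW _ N.+1); apply: sv; rewrite mem_head.
  by move=> x xp; apply: (@source_boxW _ N.+1); apply: sv; rewrite inE xp orbT.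
apply: front_room => //; rewrite -/rho.
apply: leq_trans qN; rewrite /K addnS expnS expnD.
exact: leq_mul.
Qed.

(** * Summation over [N] *)

Section final.
Context {R : realType} {disp : measure_display} {T : measurableType disp}.
Variable P : probability T R.

(** Uses [1/x^2 <= 1/(x-1) - 1/x]; the telescoping sum is at most [1/(a-1) <= 1]. *)
Lemma measure_bigcup_telescope (A : nat -> set T) (K : R) (a : nat) :
  (2 <= a)%N -> 0 <= K -> (forall i, measurable (A i)) ->
  (forall i, (P (A i) <= (K / (a + i)%:R ^+ 2)%:E)%E) ->
  (P (\bigcup_i A i) <= K%:E)%E.
Proof.
move=> a2 K0 mA PA.
apply: le_trans (le_mu_bigcup _ mA _) _; first exact: bigcupT_measurable.
apply: lime_le; first by apply: is_cvg_nneseries => i _ _; exact: measure_ge0.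
apply: nearW => k; rewrite big_mkord.
have aS i : (0 : R) < (a + i)%:R by rewrite ltr0n; lia.
have aP : (1 : R) <= a%:R - 1 by rewrite lerBrDr -[1 + 1]/(2%:R) ler_nat.
have ai i : (1 : R) <= (a + i)%:R - 1.
  by apply: le_trans aP _; rewrite lerD2r ler_nat leq_addr.
suff tele : (\sum_(i < k) P (A i) <= (K * ((a%:R - 1)^-1 - ((a + k)%:R - 1)^-1))%:E)%E.
  apply: le_trans tele _; rewrite lee_fin ler_piMr // lerBlDr.
  apply: (@le_trans _ _ 1); first by rewrite invf_le1 // (lt_le_trans ltr01).
  by rewrite lerDl invr_ge0 (le_trans ler01).
elim: k => [|k IH]; first by rewrite big_ord0 addn0 subrr mulr0.
rewrite big_ord_recr /=; apply: le_trans (leeD IH (PA k)) _.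
rewrite -EFinD lee_fin -mulrDr ler_wpM2l //.
have x1 := ai k; rewrite addnS -natr1 addrK; move: x1 (aS k).
move: ((a + k)%:R : R) => x x1 x0; have xm : 0 < x - 1 by lra.
suff : 0 <= (x - 1)^-1 - x^-1 - (x ^+ 2)^-1.
  by move: (x - 1)^-1 x^-1 (x ^+ 2)^-1 (a%:R - 1)^-1 => x2 x3 x4 x5; lra.
have -> : (x - 1)^-1 - x^-1 - (x ^+ 2)^-1 = ((x - 1) * x ^+ 2)^-1.
  by field; rewrite !gt_eqF.
by rewrite invr_ge0 mulr_ge0 ?exprn_ge0 // ltW.
Qed.

End final.

Theorem theorem1p3 (R : realType) (d n : nat) (hd : (2 <= d)%N)
    (hn : (1 <= n)%N) (L : R) (hL : 1 <= L) :
  exists C : R, 0 < C /\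
    forall (disp : measure_display) (T : measurableType disp)
      (P : probability T R) (tau : site d -> nat -> T -> R)
      (S : site d -> nat -> nat -> T -> site d),
      idla_inputs P tau S ->
      forall M : nat, (1 <= M)%N ->
        let t := fun w z j => tau z j w in
        let s := fun w z j k => S z j k w in
        ((1 - C / (M%:R `^ L))%:E <=
         P [set w | aggregate_oo n (t w) (s w) `&` cylinder M =
                    aggregate n (t w) (s w) (2 * M) `&` cylinder M])%E.
Proof.
have d0 : (0 < d)%N by exact: ltnW.
pose p := (Num.trunc L).+1; have Lp : L <= p%:R by exact/ltW/truncnS_gt.
(* The two extra powers make the bounds summable over [N >= 2M]. *)
have [C1 [N0 [C10 step]]] := @one_step R d n (p + 2) d0.
(* The term [N0^L] makes the claim trivial when [2M < N0], where [one_step] gives nothing. *)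
exists (C1 + 1 + N0%:R `^ L); split.
  by rewrite ltr_pwDl ?powR_ge0 // ltr_pwDr.
move=> disp T P tau S inputs M M1 /=.
pose t := fun w z j => tau z j w; pose s := fun w z j k => S z j k w.
rewrite -/t -/s.
have M1R : 1 <= M%:R :> R by rewrite ler1n.
have ML0 : 0 < M%:R `^ L by rewrite powR_gt0 // ltr0n.
have mE := measurable_stabilized n inputs M.
have [MN|MN] := leqP N0 (2 * M); last first.
  apply: (@le_trans _ _ 0%E); last exact: measure_ge0.
  rewrite lee_fin subr_le0 ler_pdivlMr // mul1r.
  apply: (@le_trans _ _ (N0%:R `^ L)); last by rewrite lerDr addr_ge0.
  have L0 : 0 <= L by exact: le_trans hL.
  have MN' : (M <= N0)%N by lia.
  by apply: (ge0_ler_powR L0); rewrite ?nnegrE ?ler_nat ?ler0n.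
have Bex i : exists Bad : set T, [/\ measurable Bad,
    (P Bad <= (C1 / (2 * M + i)%N%:R ^+ (p + 2))%:E)%E &
    forall w, ~ Bad w -> (forall z, source z -> forall j, tau z j w < tau z j.+1 w) ->
    (forall M', (2 * M' <= 2 * M + i)%N ->
      aggregate n (t w) (s w) (2 * M + i).+1 `&` cylinder M' =
      aggregate n (t w) (s w) (2 * M + i) `&` cylinder M') /\
    (forall M1 M2, (M1 <= M2 <= (2 * M + i).+1)%N ->
      aggregate n (t w) (s w) M1 `<=` aggregate n (t w) (s w) M2)].
  by apply: (step disp T P tau S inputs); exact: leq_trans (leq_addr _ _).
have [B BP] := choice Bex.
have nullz : P.-negligible [set w | exists z, source z /\ ~ forall j, tau z j w < tau z j.+1 w].
  apply: negligible_ex => z; have [sz|nsz] := pselect (source z); last first.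
    by apply: negligibleS (negligible_set0 _) => w [].
  have [pp _ _] := inputs; have [_ incr _] := pp z sz.
  by apply: negligibleS incr => w [_ nj] /= [].
have [Nul [mNul Nul0 NulP]] := nullz.
have mB i : measurable (B i) by case: (BP i).
have mU : measurable (\bigcup_i B i) by exact: bigcupT_measurable.
have PB : (P (\bigcup_i B i) <= (C1 / M%:R ^+ p)%:E)%E.
  apply: (@measure_bigcup_telescope R _ T P B _ (2 * M)%N) => //.
  - by rewrite leq_pmulr.
  - by rewrite divr_ge0 // exprn_ge0.
  move=> i; have [_ PBi _] := BP i; apply: le_trans PBi _; rewrite lee_fin.
  have x0 : (0 : R) < (2 * M + i)%N%:R by rewrite ltr0n; lia.
  have xM : M%:R <= (2 * M + i)%N%:R :> R by rewrite ler_nat; lia.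
  rewrite exprD invfM mulrA; apply: ler_wpM2r.
    by rewrite invr_ge0 exprn_ge0 // ltW.
  apply: ler_wpM2l => //.
  have Mp0 : (0 : R) < M%:R ^+ p by rewrite exprn_gt0 // (lt_le_trans ltr01).
  have xp0 : (0 : R) < (2 * M + i)%N%:R ^+ p by rewrite exprn_gt0.
  rewrite lef_pV2 //; apply: lerXn2r => //; by rewrite nnegrE ler0n.
have sub : ~` [set w | aggregate_oo n (t w) (s w) `&` cylinder M =
    aggregate n (t w) (s w) (2 * M) `&` cylinder M] `<=` \bigcup_i B i `|` Nul.
  move=> w; apply: contra_notP => /not_orP[nB nN] /=.
  have incr z : source z -> forall j, tau z j w < tau z j.+1 w.
    by move=> sz; apply: contrapT => nj; apply: nN; apply: NulP; exists z.
  have good i := let: And3 _ _ h := BP i in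
    h w (fun Bi => nB (ex_intro2 _ _ i Logic.I Bi)) incr.
  have stab i : aggregate n (t w) (s w) (2 * M + i) `&` cylinder M =
      aggregate n (t w) (s w) (2 * M) `&` cylinder M.
    elim: i => [|i IH]; first by rewrite addn0.
    by rewrite addnS -IH; apply: (good i).1; exact: leq_addr.
  apply/seteqP; split => x [] ; last by move=> xA xM; split => //; exists (2 * M)%N.
  (* Any [M'] is at most [2M + M'], so by monotonicity [x] lies in the aggregate of [2M + M'], which
     agrees with that of [2M] on [Z_M]. *)
  move=> [M' _ xA] xM; rewrite -(stab M'); split => //.
  by apply: (good M').2 xA; lia.
have : (P (~` [set w | aggregate_oo n (t w) (s w) `&` cylinder M =
    aggregate n (t w) (s w) (2 * M) `&` cylinder M]) <= (C1 / M%:R ^+ p)%:E)%E.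
  apply: le_trans (_ : _ <= P (\bigcup_i B i `|` Nul))%E _.
    by rewrite le_measure ?inE //; [exact: measurableC | exact: measurableU].
  apply: (@le_trans _ _ (P (\bigcup_i B i) + P Nul)%E); first exact: measureU2.
  have -> : P Nul = 0%E by exact: Nul0.
  by rewrite adde0.
rewrite probability_setC //.
have Pf := fin_num_measure P _ mE.
rewrite -(fineK Pf) -EFinB !lee_fin => h.
have MpL : M%:R `^ L <= M%:R ^+ p by rewrite -powR_mulrn // ler_powR.
have : C1 / M%:R ^+ p <= (C1 + 1 + N0%:R `^ L) / M%:R `^ L.
  apply: ler_pM; rewrite ?invr_ge0 ?exprn_ge0 //.
    by rewrite -addrA lerDl addr_ge0 ?powR_ge0.
  by rewrite lef_pV2 ?posrE ?exprn_gt0 // ltr0n.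
by move: h; rewrite lerBlDr; lra.
Qed.
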